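(* Fix integers $d \geq 1$ and $0 \leq p \leq d-1$, and put $m = \min\{p+1, \lceil d/2 \rceil\}$. For every $N \geq 1$ there is a set $A_N$ of $N$ points in $\mathbb{R}^d$ and a radius $r_N \geq 0$ such that the $p$-th Betti number of the Čech complex of $A_N$ at radius $r_N$ satisfies $\beta_p = \Theta(N^m)$ as $N \to \infty$ (with $d$ and $p$ fixed).
   Context: For a finite set $A \subseteq \mathbb{R}^d$ and $r \geq 0$, the Čech complex of $A$ and $r$ is the abstract simplicial complex consisting of all nonempty subsets $\Sigma \subseteq A$ such that the closed balls of radius $r$ centered at the points of $\Sigma$ have a nonempty common intersection (equivalently, the nerve of these balls). Betti numbers are reduced Betti numbers, i.e. ranks of the reduced homology groups. *)

(* Defs.v *)
From HB Require Import structures.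
From mathcomp Require Import all_boot all_order all_algebra finmap.
From mathcomp Require Import boolp reals.

Set Implicit Arguments.
Unset Strict Implicit.
Unset Printing Implicit Defensive.

Import Order.TTheory GRing.Theory Num.Theory.

Local Open Scope ring_scope.

(* A simplicial complex on a finite vertex type V is given by its set of
   nonempty faces K : {set {set V}}.  Chains of all dimensions live in the
   single space {ffun {set V} -> F}; the coordinate at set0 is the
   (-1)-dimensional chain group of the augmented complex. *)
Section Homology.
Variables (F : fieldType) (V : finType).

Notation chainType := {ffun {set V} -> F^o}.

(* Simplices are oriented by the enumeration order of V: removing v from
   v |: T contributes (-1)^i, where i is the position of v in v |: T. *)
Definition incidence_sign (v : V) (T : {set V}) : F :=
  (-1) ^+ #|[set w in T | (enum_rank w < enum_rank v)%N]|.

(* On a 0-chain the coefficient at T = set0 is the sum of the coefficients, so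
   this is the differential of the augmented chain complex. *)
Definition boundary_fun (c : chainType) : chainType :=
  [ffun T : {set V} => \sum_(v | v \notin T) incidence_sign v T * c (v |: T)].

Fact boundary_fun_is_linear : linear boundary_fun.
Proof.
move=> a c e; apply/ffunP => T; rewrite !ffunE scaler_sumr -big_split /=.
by apply: eq_bigr => v _; rewrite !ffunE mulrDr [in RHS]/GRing.scale /= mulrCA.
Qed.

HB.instance Definition _ :=
  GRing.isLinear.Build F chainType chainType _ boundary_fun
    boundary_fun_is_linear.

Definition boundary : 'End(chainType) := linfun boundary_fun.

Definition simplex_chain (S : {set V}) : chainType := [ffun T : {set V} => (T == S)%:R].

Definition chains (K : {set {set V}}) (p : nat) : {vspace chainType} :=
  (\sum_(S in K | #|S| == p.+1) <[simplex_chain S]>)%VS.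

Definition cycles (K : {set {set V}}) (p : nat) : {vspace chainType} :=
  (chains K p :&: lker boundary)%VS.

Definition boundaries (K : {set {set V}}) (p : nat) : {vspace chainType} :=
  (boundary @: chains K p.+1)%VS.

(* The dimension of the quotient cycles / boundaries; the subtraction is not
   truncated, see boundaries_sub_cycles. *)
Definition reduced_betti (K : {set {set V}}) (p : nat) : nat :=
  (\dim (cycles K p) - \dim (boundaries K p))%N.

Definition simplicial_complex (K : {set {set V}}) : Prop :=
  set0 \notin K /\
  forall S T : {set V}, S \in K -> T \subset S -> T != set0 -> T \in K.

End Homology.

Definition euclidean_dist (R : realType) (d : nat) (x y : 'rV[R]_d) : R :=
  Num.sqrt (\sum_(i < d) (x 0 i - y 0 i) ^+ 2).

(* The balls are Euclidean, unlike those of the library's (sup) norm on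
   'rV[R]_d. *)
Definition cech_complex (R : realType) (d : nat) (A : {fset 'rV[R]_d}) (r : R) :
    {set {set A}} :=
  [set S : {set A} | (S != set0) &&
     `[< exists x : 'rV[R]_d,
           forall a : A, a \in S -> euclidean_dist x (val a) <= r >]].

Section Facts.
Variables (F : fieldType) (V : finType).
Implicit Types (K : {set {set V}}) (S T : {set V}).

Lemma cech_complexP (R : realType) (d : nat) (A : {fset 'rV[R]_d}) (r : R) :
  simplicial_complex (cech_complex A r).
Proof.
split=> [|S T]; first by rewrite inE eqxx.
rewrite !inE => /andP[_ /asboolP[x xS]] /fintype.subsetP TS -> /=.
by apply/asboolP; exists x => a /TS /xS.
Qed.

Lemma incidence_signC (v w : V) T : v \notin T -> w \notin T -> v != w ->
  incidence_sign F v T * incidence_sign F w (v |: T) =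
  - (incidence_sign F w T * incidence_sign F v (w |: T)).
Proof.
move=> vT wT vw.
have signU (x y : V) : x \notin T ->
    incidence_sign F y (x |: T) =
    (-1) ^+ (enum_rank x < enum_rank y)%N * incidence_sign F y T.
  move=> xT; rewrite /incidence_sign -exprD; congr (_ ^+ _).
  case: (boolP (enum_rank x < enum_rank y)%N) => xy.
    have -> : [set z in x |: T | (enum_rank z < enum_rank y)%N] =
        x |: [set z in T | (enum_rank z < enum_rank y)%N].
      by apply/setP => z; rewrite !inE; case: eqVneq => // ->; rewrite xy.
    by rewrite cardsU1 inE (negbTE xT).
  congr #|pred_of_set _|; apply/setP => z; rewrite !inE.
  by case: eqVneq => // ->; rewrite (negbTE xy) ?andbF.
rewrite !signU //.
have : enum_rank v != enum_rank w :> nat.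
  by apply: contraNneq vw => /val_inj/enum_rank_inj ->.
rewrite neq_ltn => /orP[] lt_; rewrite lt_ ltnNge (ltnW lt_) /=;
  by rewrite expr1 expr0 mul1r mulN1r ?mulrN ?opprK mulrC.
Qed.

Lemma boundary_funK (c : {ffun {set V} -> F^o}) :
  boundary_fun (boundary_fun c) = 0.
Proof.
apply/ffunP => T; rewrite !ffunE.
pose f v w := incidence_sign F v T * (incidence_sign F w (v |: T) *
                c (w |: (v |: T))).
pose P v w := [&& v \notin T, w \notin T & v != w].
pose lt (v w : V) := (enum_rank v < enum_rank w)%N.
transitivity (\sum_v \sum_(w | P v w) f v w).
  rewrite big_mkcond; apply: eq_bigr => v _.
  case: ifPn => vT; last by rewrite big_pred0 // => w; rewrite /P (negbTE vT).
  rewrite ffunE big_distrr /=; apply: eq_bigl => w.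
  by rewrite /P vT !inE negb_or andbC eq_sym.
transitivity (\sum_v \sum_(w | P v w && lt v w) f v w +
              \sum_v \sum_(w | P v w && ~~ lt v w) f v w).
  by rewrite -big_split; apply: eq_bigr => v _; rewrite -bigID.
rewrite [X in _ + X](exchange_big_dep xpredT) //=.
rewrite -big_split big1 // => v _ /=.
rewrite [X in _ + X](eq_bigl (fun w => P v w && lt v w)) => [|w]; last first.
  rewrite /P /lt (eq_sym w v); case: eqVneq => [->|vw]; first by rewrite !andbF.
  have /negbTE nvw : enum_rank v != enum_rank w :> nat.
    by apply: contraNneq vw => /val_inj/enum_rank_inj ->.
  by rewrite -leqNgt leq_eqVlt nvw /=; case: (v \in T); case: (w \in T).
rewrite -big_split big1 // => w /andP[/and3P[vT wT vw] _] /=.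
by rewrite /f !mulrA (incidence_signC vT wT vw) setUCA mulNr addNr.
Qed.

Lemma chainsP K p (c : {ffun {set V} -> F^o}) :
  reflect (forall S, c S != 0 -> S \in K /\ #|S| = p.+1) (c \in chains F K p).
Proof.
apply: (iffP memv_sumP) => [[u uP ->] S|cP].
  rewrite sum_ffunE => /eqP cS0.
  case: (boolP ((S \in K) && (#|S| == p.+1))) => [/andP[? /eqP] //|SK].
  case: cS0; apply: big1 => T TK.
  have /vlineP[k ->] := uP T TK.
  rewrite !ffunE; case: eqP => [ST|_]; last by rewrite scaler0.
  by rewrite ST TK in SK.
exists (fun S => c S *: simplex_chain F S) => [S _|].
  by rewrite memvZ // memv_line.
apply/ffunP => T; rewrite sum_ffunE.
under eq_bigr do rewrite !ffunE.
case: (boolP ((T \in K) && (#|T| == p.+1))) => [TK|TK].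
  rewrite (bigD1 T) //= eqxx big1 ?addr0 => [|S /andP[_ ST]].
    by rewrite [RHS]mulr1.
  by rewrite eq_sym (negbTE ST) scaler0.
rewrite big1 => [|S SK].
  by apply/eqP; apply: contraNT TK => /cP[-> ->]; rewrite eqxx.
case: eqP => [TS|_]; last by rewrite scaler0.
by rewrite TS SK in TK.
Qed.

Lemma boundaries_sub_cycles K p : simplicial_complex K ->
  (boundaries F K p <= cycles F K p)%VS.
Proof.
move=> [_ Kdown]; apply/subvP => _ /memv_imgP[c /chainsP cP ->].
rewrite memv_cap memv_ker !lfunE /= boundary_funK eqxx andbT.
apply/chainsP => S; rewrite ffunE => bS.
have [v vS /cP[vSK]] : exists2 v, v \notin S & c (v |: S) != 0.
  apply: contrapT => nv; move/eqP: bS; apply; apply: big1 => v vS.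
  have [->|cv] := eqVneq (c (v |: S)) 0; first by rewrite mulr0.
  by case: nv; exists v.
rewrite cardsU1 vS => -[cardS]; split=> //.
apply: (Kdown _ _ vSK); first exact: subsetUr.
by rewrite -card_gt0 -[#|S|]add0n cardS.
Qed.

End Facts.

(* Main.v *)
(* Put k = min (p + 1, ceil (d / 2)).  At the vertices of a regular simplex of
   R^(k-1) place k short arcs pointing into pairwise orthogonal further directions,
   and put about N / k equidistant points on each arc.  The arcs are bent so that, to
   second order, the squared circumradius of a simplex meeting all the arcs is a
   constant plus a multiple of the sum of the squared lengths of its traces on the
   arcs, while simplices missing an arc have a smaller circumradius.  A suitable
   radius thus allows, among the simplices meeting all the arcs, exactly those whose
   sum of squared lengths (in units of the spacing) is at most s = p + 1 - k.
   Upper bound: toggling a vertex strictly inside the trace of a simplex on an arc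
   leaves the complex invariant, and this matching has O(N^k) critical simplices, since
   their traces are empty, single points or pairs of neighbours.
   Lower bound: choosing one point on each arc, and doubling it on s + 1 of the arcs,
   gives a non-face whose boundary is a p-cycle, and these Theta(N^k) cycles are
   triangular with respect to maximal faces of the complex.
   If p = d - 1 and d = 2 k > 2, so that s would be k, the same complex with s = k - 1 is
   suspended by two poles in the one direction that is left. *)

Require Import Defs.
From HB Require Import structures.
From mathcomp Require Import all_boot all_order all_algebra finmap.
From mathcomp Require Import boolp reals.
From mathcomp Require Import zify ring lra.

Set Implicit Arguments.
Unset Strict Implicit.
Unset Printing Implicit Defensive.

Import Order.TTheory GRing.Theory Num.Theory.

Local Open Scope ring_scope.

(** * Linear algebra of simplicial chains *)

Notation chain F V := {ffun {set V} -> F^o}.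

(** Among the indices with nonzero coefficient, one of maximal rank would be the only one to
    contribute at its own face. *)
Lemma triangular_combination_eq0 (F : fieldType) (V I : finType)
    (z : I -> chain F V) (face : I -> {set V}) (rk : I -> nat) (a : I -> F) :
  (forall i, z i (face i) != 0) ->
  (forall i j, z i (face j) != 0 -> i = j \/ (rk j < rk i)%N) ->
  (forall j, \sum_i a i * z i (face j) = 0) -> forall i, a i = 0.
Proof.
move=> zdiag ztri az0 i0; apply/eqP/negPn/negP => ai0.
case: (arg_maxnP rk (P := fun i => a i != 0) ai0) => i ai imax.
have := az0 i; rewrite (bigD1 i) //= big1 ?addr0 => [/eqP|j ji].
  by rewrite mulf_eq0 (negbTE ai) (negbTE (zdiag i)).
apply/eqP; rewrite mulf_eq0; case: eqP => //= /eqP aj.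
apply/negPn/negP => /ztri[jE|]; first by rewrite jE eqxx in ji.
by move: (imax _ aj); rewrite /= leqNgt => /negbTE ->.
Qed.

(** Evaluation at the faces kills [B] and is triangular on the [z i], so these are independent
    modulo [B]. It is applied with [B] zero for the Morse inequality and with [B] the boundaries for
    the lower bound. *)
Lemma dimv_add_triangular (F : fieldType) (V I : finType)
    (B U : {vspace chain F V}) (z : I -> chain F V) (face : I -> {set V})
    (rk : I -> nat) :
  (B <= U)%VS -> (forall i, z i \in U) ->
  (forall b i, b \in B -> b (face i) = 0) ->
  (forall i, z i (face i) != 0) ->
  (forall i j, z i (face j) != 0 -> i = j \/ (rk j < rk i)%N) ->
  (\dim B + #|I| <= \dim U)%N.
Proof.
move=> BU zU Bface zdiag ztri.
pose X := [tuple z (enum_val i) | i < #|I|].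
have XE i : X`_i = nth 0 X i by [].
have indep (k : 'I_#|I| -> F) :
    (forall j, (\sum_i k i *: X`_i : chain F V) (face j) = 0) ->
    forall i, k i = 0.
  move=> kX i; rewrite -(enum_valK i).
  apply: (triangular_combination_eq0 (a := fun i => k (enum_rank i)) zdiag ztri).
  move=> j; rewrite -[RHS](kX j) sum_ffunE.
  rewrite (reindex (enum_val (A := I))) /=; last first.
    by exists enum_rank => l _; rewrite ?enum_valK ?enum_rankK.
  apply: eq_bigr => l _; rewrite !ffunE enum_valK.
  by rewrite (nth_map l) ?size_enum_ord // nth_ord_enum.
have freeX : free X.
  apply/freeP => k kX; apply: indep => j.
  by rewrite kX ffunE.
have BX0 : (B :&: <<X>> = 0)%VS.
  apply/eqP; rewrite -subv0; apply/subvP => c /memv_capP[cB cX].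
  rewrite memv0 (coord_span cX) big1 // => i _.
  rewrite (indep (fun i => coord X i c)) ?scale0r // => j.
  by rewrite -(coord_span cX) Bface.
have XU : (<<X>> <= U)%VS.
  apply/span_subvP => x /mapP[i _ ->]; exact: zU.
have := freeX; rewrite /free size_tuple => /eqP dX.
rewrite -dX -dimv_disjoint_sum //; apply: dimvS.
by rewrite subv_add BU.
Qed.

Definition restrict_fun (F : fieldType) (V : finType) (D : {set {set V}})
  (c : chain F V) : chain F V := [ffun S => if S \in D then c S else 0].

Fact restrict_fun_is_linear (F : fieldType) (V : finType) (D : {set {set V}}) :
  linear (@restrict_fun F V D).
Proof.
move=> a b c; apply/ffunP => S; rewrite !ffunE; case: ifP => // _.
by rewrite scaler0 addr0.
Qed.

HB.instance Definition _ (F : fieldType) (V : finType) (D : {set {set V}}) :=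
  GRing.isLinear.Build F (chain F V) (chain F V) _ (@restrict_fun F V D)
    (@restrict_fun_is_linear F V D).

(** Restriction to [D] is injective on [U], and its image lies in the span of [#|D|] simplex
    chains. *)
Lemma dimv_le_card (F : fieldType) (V : finType) (D : {set {set V}})
    (U : {vspace chain F V}) :
  (forall c, c \in U -> (forall S, S \in D -> c S = 0) -> c = 0) ->
  (\dim U <= #|D|)%N.
Proof.
move=> UD; pose f := linfun (@restrict_fun F V D).
have kerf0 : (U :&: lker f = 0)%VS.
  apply/eqP; rewrite -subv0; apply/subvP => c /memv_capP[cU].
  rewrite memv_ker lfunE /= memv0 => /eqP cD; apply/eqP/UD => // S SD.
  by move/ffunP/(_ S): cD; rewrite !ffunE SD.
rewrite -(limg_dim_eq kerf0).
have sub : (f @: U <= \sum_(S in D) <[simplex_chain F S]>)%VS.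
  apply/subvP => _ /memv_imgP[c _ ->]; rewrite lfunE /=.
  have -> : restrict_fun D c = \sum_(S in D) c S *: simplex_chain F S.
    apply/ffunP => T; rewrite !ffunE sum_ffunE.
    case: ifP => [TD|/negP TD].
      rewrite (bigD1 T) //= !ffunE eqxx big1 ?addr0 => [|S /andP[_ ST]].
        by rewrite [RHS]mulr1.
      by rewrite !ffunE eq_sym (negbTE ST) scaler0.
    rewrite big1 // => S SD; rewrite !ffunE; case: eqP => [TS|_].
      by rewrite TS SD in TD.
    by rewrite scaler0.
  by apply: memv_sumr => S _; rewrite memvZ // memv_line.
have dimsum := dimv_leq_sum (index_enum {set V}) (fun S => S \in D)
  (fun S => <[simplex_chain F S]>%VS).
apply: leq_trans (dimvS sub) _; apply: leq_trans dimsum _.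
rewrite -sum1_card; apply: leq_sum => S _.
by rewrite dim_vline; case: eqP.
Qed.

Lemma incidence_sign_neq0 (F : fieldType) (V : finType) (v : V) (T : {set V}) :
  incidence_sign F v T != 0.
Proof. by rewrite signr_eq0. Qed.

Lemma boundary_simplexE (F : fieldType) (V : finType) (S T : {set V}) :
  boundary_fun (simplex_chain F S) T =
  \sum_(v | (v \notin T) && (v |: T == S)) incidence_sign F v T.
Proof.
rewrite ffunE [RHS]big_mkcondr /=; apply: eq_bigr => v _.
by rewrite ffunE; case: eqP; rewrite ?mulr1 ?mulr0.
Qed.

Lemma boundary_simplex_setU1 (F : fieldType) (V : finType) (v : V) (T : {set V}) :
  v \notin T ->
  boundary_fun (simplex_chain F (v |: T)) T = incidence_sign F v T.
Proof.
move=> vT; rewrite boundary_simplexE (bigD1 v) ?vT ?eqxx //= big1 ?addr0 //.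
move=> w /andP[/andP[wT /eqP wE] wv]; move: (setU11 w T).
by rewrite wE !inE (negbTE wv) (negbTE wT).
Qed.

Lemma boundary_simplex_neq0 (F : fieldType) (V : finType) (S T : {set V}) :
  boundary_fun (simplex_chain F S) T != 0 ->
  exists2 v, v \notin T & v |: T = S.
Proof.
rewrite boundary_simplexE => H.
suff [v /andP[vT /eqP SE]] : exists v, (v \notin T) && (v |: T == S).
  by exists v.
apply: contrapT => nv; case/eqP: H; apply: big1 => v vP.
by case: nv; exists v.
Qed.

(* A matching of K pairs each tail T with the head v T |: T; everything else is
   critical.  Only the weak Morse inequality is needed, so the acyclicity is
   expressed by the ranking rk of the tails. *)
Lemma reduced_betti_le_critical (F : fieldType) (V : finType)
    (K tail crit : {set {set V}}) (p : nat) (v : {set V} -> V)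
    (rk : {set V} -> nat) :
  (forall T, T \in tail -> v T \notin T /\ v T |: T \in K) ->
  (forall T T', T \in tail -> T' \in tail -> T \subset v T' |: T' ->
    #|T| = #|T'| -> T = T' \/ (rk T < rk T')%N) ->
  (forall S, S \in K -> #|S| = p.+1 ->
    [\/ S \in crit, S \in tail |
        exists2 T, T \in tail & S = v T |: T]) ->
  (reduced_betti F K p <= #|crit|)%N.
Proof.
move=> tailK tailrk Kcases.
pose tl q := [set T in tail | #|T| == q].
have tlv q T : T \in tl q -> [/\ T \in tail, #|T| = q, v T \notin T & v T |: T \in K].
  by rewrite inE => /andP[Tt /eqP]; have [] := tailK T Tt.
have diag q (i : {T | T \in tl q}) :
    boundary_fun (simplex_chain F (v (val i) |: val i)) (val i) != 0.
  case: i => T /= /tlv[_ _ vT _].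
  by rewrite boundary_simplex_setU1 // incidence_sign_neq0.
have tri q (i j : {T | T \in tl q}) :
    boundary_fun (simplex_chain F (v (val i) |: val i)) (val j) != 0 ->
    i = j \/ (rk (val j) < rk (val i))%N.
  case: i j => [T Tq] [T' Tq'] /= /boundary_simplex_neq0[w _ wE].
  have sub : T' \subset v T |: T by rewrite -wE subsetUr.
  have [Tt cT _ _] := tlv _ _ Tq; have [Tt' cT' _ _] := tlv _ _ Tq'.
  have [|TT|] := tailrk T' T Tt' Tt sub; first by rewrite cT.
    by left; apply: val_inj.
  by right.
(* Every tail with [p.+1] vertices contributes the boundary of its head; evaluated at the tails,
   these boundaries are triangular. *)
have dimB : (#|tl p.+1| <= \dim (boundaries F K p))%N.
  suff : (\dim (0%VS : {vspace chain F V}) + #|{: {T | T \in tl p.+1}}| <=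
      \dim (boundaries F K p))%N by rewrite dimv0 card_sig.
  apply: (dimv_add_triangular (z := fun i : {T | T \in tl p.+1} =>
    boundary_fun (simplex_chain F (v (val i) |: val i)))
    (face := fun i : {T | T \in tl p.+1} => val i)
    (rk := fun i : {T | T \in tl p.+1} => rk (val i))) => //=.
  - exact: sub0v.
  - case=> T Tp; have [_ cT vT vTK] := tlv _ _ Tp => /=.
    rewrite -[boundary_fun _](lfunE (boundary_fun (F := F) (V := V))) /=.
    apply: memv_img; apply/chainsP => S; rewrite ffunE.
    have [->|_] := eqVneq S (v T |: T); rewrite ?eqxx // => _; split=> //.
    by rewrite cardsU1 vT cT.
  - by move=> b i; rewrite memv0 => /eqP ->; rewrite ffunE.
  - exact: diag.
  - exact: tri.
(* A cycle that vanishes on the critical simplices and on the tails is supported on heads of tails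
   with [p] vertices. Evaluating its boundary at those tails gives a triangular system, so it is
   zero. *)
have dimZ : (\dim (cycles F K p) <= #|crit :|: tl p.+1|)%N.
  apply: dimv_le_card => c /memv_capP[/chainsP cK].
  rewrite memv_ker lfunE /= => /eqP bc0 c0.
  have chead S : c S != 0 -> exists2 T, T \in tl p & S = v T |: T.
    move=> cS; have [SK cardS] := cK _ cS.
    have c0' : S \notin crit :|: tl p.+1.
      by apply: contraNN cS => /c0 ->.
    move: c0'; rewrite !inE cardS eqxx andbT negb_or => /andP[Sc St].
    have [Sc'|St'|[T Tt SE]] := Kcases S SK cardS.
    + by rewrite Sc' in Sc.
    + by rewrite St' in St.
    exists T => //; rewrite inE Tt /=; have [vT _] := tailK T Tt.
    by move: cardS; rewrite SE cardsU1 vT add1n => -[->].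
  have cE : c = \sum_(i : {T | T \in tl p})
      c (v (val i) |: val i) *: simplex_chain F (v (val i) |: val i).
    apply/ffunP => S; rewrite sum_ffunE.
    have [cS0|/chead[T Tp SE]] := eqVneq (c S) 0.
      rewrite cS0 big1 // => i _; rewrite !ffunE; case: eqP => [<-|_].
        by rewrite cS0 scale0r.
      by rewrite scaler0.
    rewrite (bigD1 (exist _ T Tp)) //= !ffunE -SE eqxx big1 ?addr0.
      by rewrite [RHS]mulr1.
    move=> [T' Tp'] /= TT; rewrite !ffunE; case: eqP => [SE'|]; last first.
      by rewrite scaler0.
    (* Two distinct tails with the same head would each have smaller rank than the other. *)
    case/negP: TT; apply/eqP/val_inj => /=.
    have [Tt cT vT _] := tlv _ _ Tp; have [Tt' cT' vT' _] := tlv _ _ Tp'.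
    have [||//|lt1] := tailrk T' T Tt' Tt; rewrite ?cT //.
      by rewrite -SE SE' subsetUr.
    have [||//|lt2] := tailrk T T' Tt Tt'; rewrite ?cT //.
      by rewrite -SE' SE subsetUr.
    by move: (ltn_trans lt1 lt2); rewrite ltnn.
  rewrite cE big1 // => i _.
  rewrite (triangular_combination_eq0 (I := {T | T \in tl p})
    (a := fun i => c (v (val i) |: val i)) (diag p) (tri p)) ?scale0r //.
  move=> j; rewrite -[RHS](ffunE (fun=> 0 : F^o) (val j)).
  have -> : [ffun=> 0] = boundary_fun c by rewrite bc0.
  rewrite {2}cE linear_sum sum_ffunE; apply: eq_bigr => l _.
  by rewrite linearZ [RHS]ffunE.
rewrite /reduced_betti leq_subLR addnC.
apply: (leq_trans dimZ); apply: (leq_trans (leq_card_setU _ _)).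
by rewrite leq_add2l.
Qed.

(* Boundaries vanish on the maximal faces of K, so cycles that are independent on
   maximal faces are independent in homology. *)
Lemma reduced_betti_ge_maximal_faces (F : fieldType) (V I : finType)
    (K : {set {set V}}) (p : nat) (x : I -> chain F V) (face : I -> {set V})
    (rk : I -> nat) :
  simplicial_complex K ->
  (forall i S, boundary_fun (x i) S != 0 -> S \in K /\ #|S| = p.+1) ->
  (forall i v, v \notin face i -> v |: face i \notin K) ->
  (forall i, boundary_fun (x i) (face i) != 0) ->
  (forall i j, boundary_fun (x i) (face j) != 0 -> i = j \/ (rk j < rk i)%N) ->
  (#|I| <= reduced_betti F K p)%N.
Proof.
move=> Ksc xK maxface diag tri.
have BZ := boundaries_sub_cycles F p Ksc.
rewrite /reduced_betti leq_subRL ?dimvS //.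
apply: (dimv_add_triangular (z := fun i => boundary_fun (x i)) BZ _ _ diag tri).
  move=> i; rewrite memv_cap memv_ker lfunE /= boundary_funK eqxx andbT.
  by apply/chainsP => S; apply: xK.
move=> b i /memv_imgP[c /chainsP cK ->]; rewrite lfunE /= ffunE.
apply: big1 => w wf; have [->|cw] := eqVneq (c (w |: face i)) 0.
  by rewrite mulr0.
by have [] := cK _ cw; rewrite (negbTE (maxface _ _ wf)).
Qed.

(** * Complexes on arcs *)

Definition hull_interior (k : nat) (V : finType) (piece : V -> option 'I_k)
    (pos : V -> nat) (S : {set V}) : {set V} :=
  [set v | [exists a in S, exists b in S,
    [&& piece a == piece v, piece b == piece v,
        (pos a < pos v)%N & (pos v < pos b)%N]]].

Lemma hull_interiorP (k : nat) (V : finType) (piece : V -> option 'I_k)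
    (pos : V -> nat) (S : {set V}) (v : V) :
  reflect (exists a b, [/\ a \in S, b \in S, piece a = piece v,
      piece b = piece v & (pos a < pos v < pos b)%N])
    (v \in hull_interior piece pos S).
Proof.
rewrite inE; apply: (iffP existsP) => [[a /andP[aS /existsP[b]]]|].
  by case/and5P=> bS /eqP pa /eqP pb av vb; exists a, b; rewrite av vb.
case=> a [b [aS bS pa pb /andP[av vb]]]; exists a; rewrite aS /=.
by apply/existsP; exists b; rewrite bS pa pb eqxx av vb.
Qed.

Lemma hull_interiorS (k : nat) (V : finType) (piece : V -> option 'I_k)
    (pos : V -> nat) (S T : {set V}) : S \subset T ->
  hull_interior piece pos S \subset hull_interior piece pos T.
Proof.
move=> /subsetP ST; apply/subsetP => v.
case/hull_interiorP=> a [b [/ST aT /ST bT pa pb avb]].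
by apply/hull_interiorP; exists a, b.
Qed.

(** Wherever [v] serves as one end of an enclosing pair, a vertex of [S] beyond it on the same piece
    can replace it. Thus toggling an interior vertex does not change the set from which that vertex
    is chosen. *)
Lemma hull_interior_setU1 (k : nat) (V : finType) (piece : V -> option 'I_k)
    (pos : V -> nat) (S : {set V}) (v : V) :
  v \in hull_interior piece pos S ->
  hull_interior piece pos (v |: S) = hull_interior piece pos S.
Proof.
move=> vS; apply/eqP; rewrite eqEsubset (hull_interiorS _ _ (subsetUr _ _)).
rewrite andbT; apply/subsetP => u.
case/hull_interiorP: vS => a [b [aS bS pa pb /andP[av vb]]].
case/hull_interiorP => c [e [cS eS pc pe /andP[cu ue]]].
have [c' [c'S pc' cu']] : exists c', [/\ c' \in S, piece c' = piece u &
    (pos c' < pos u)%N].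
  move: cS; rewrite !inE => /orP[/eqP cE|cS]; last by exists c.
  by exists a; rewrite pa -pc cE; split=> //; apply: ltn_trans av _; rewrite -cE.
have [e' [e'S pe' ue']] : exists e', [/\ e' \in S, piece e' = piece u &
    (pos u < pos e')%N].
  move: eS; rewrite !inE => /orP[/eqP eE|eS]; last by exists e.
  by exists b; rewrite pb -pe eE; split=> //; apply: ltn_trans vb; rewrite -eE.
by apply/hull_interiorP; exists c', e'; rewrite cu' ue'.
Qed.

(** Positions on an arc have no gaps, so a trace without interior vertices is empty, a point or a
    pair of neighbours. A starting position and two bits encode it, which gives a factor [4 * N] per
    arc; two more bits record the poles. *)
Lemma card_hull_interior0 (k N : nat) (V : finType) (piece : V -> option 'I_k)
    (pos : V -> nat) :
  injective (fun v => (piece v, pos v)) ->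
  (forall v, (pos v < N)%N) ->
  (forall v, piece v = None -> (pos v < 2)%N) ->
  (forall v i y, piece v = Some i -> (y <= pos v)%N ->
    exists2 w, piece w = Some i & pos w = y) ->
  (0 < N)%N ->
  (#|[set S : {set V} | hull_interior piece pos S == set0]| <=
    4 * (4 * N) ^ k)%N.
Proof.
case: N => // N inj posN pole contig _.
pose decode (c : {ffun 'I_k -> 'I_N.+1 * bool * bool} * (bool * bool)) :=
  [set v | match piece v with
    | Some i => ((c.1 i).1.2 && (pos v == (c.1 i).1.1)) ||
                ((c.1 i).2 && (pos v == (c.1 i).1.1.+1))
    | None => if pos v == 0%N then c.2.1 else c.2.2
    end].
suff sub : [set S | hull_interior piece pos S == set0] \subset
    decode @: [set: _].
  apply: leq_trans (subset_leq_card sub) _.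
  apply: leq_trans (leq_imset_card _ _) _.
  rewrite cardsT !card_prod card_ffun !card_prod !card_ord !card_bool.
  by rewrite mulnC [(_.+1 * 2 * 2)%N](_ : _ = 4 * N.+1)%N //; lia.
apply/subsetP => S; rewrite inE => /eqP S0.
have nint v a b : a \in S -> b \in S -> piece a = piece v ->
    piece b = piece v -> (pos a < pos v < pos b)%N -> False.
  move=> aS bS pa pb avb.
  have : v \in hull_interior piece pos S by apply/hull_interiorP; exists a, b.
  by rewrite S0 inE.
have code i : exists c : 'I_N.+1 * bool * bool, forall v, piece v = Some i ->
    (v \in S) = (c.1.2 && (pos v == c.1.1)) || (c.2 && (pos v == c.1.1.+1)).
  have [v0 /andP[v0S /eqP pv0]|empty] :=
      pickP (fun v => (v \in S) && (piece v == Some i)); last first.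
    exists (ord0, false, false) => v pv /=.
    by move: (empty v); rewrite pv eqxx andbT.
  have P0 : (v0 \in S) && (piece v0 == Some i) by rewrite v0S pv0 eqxx.
  case: (arg_minnP (P := fun v => (v \in S) && (piece v == Some i)) pos P0).
  move=> w /andP[wS /eqP pw] wmin.
  exists (Ordinal (posN w), true,
    [exists u in S, (piece u == Some i) && (pos u == (pos w).+1)]) => v pv /=.
  apply/idP/orP => [vS|[/eqP pos_vw|/andP[/existsP[u]]]].
  - have := wmin v; rewrite vS pv eqxx => /(_ isT) /=.
    rewrite leq_eqVlt => /orP[/eqP ->|]; first by left; rewrite eqxx.
    rewrite leq_eqVlt => /orP[/eqP wv|wv].
      right; rewrite -wv eqxx andbT; apply/existsP; exists v.
      by rewrite vS pv -wv !eqxx.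
    have [u pu posu] := contig v i (pos w).+1 pv (ltnW wv).
    by case: (nint u w v); rewrite ?pu ?posu // ltnSn wv.
  - by rewrite (inj v w) // pv pw pos_vw.
  - case/and3P=> uS /eqP pu /eqP posu /eqP posv.
    by rewrite (inj v u) // pu pv posu posv.
have [c cP] := fin_all_exists code.
apply/imsetP.
exists ([ffun i => c i],
  ([exists u in S, (piece u == None) && (pos u == 0%N)],
   [exists u in S, (piece u == None) && (pos u == 1%N)])); rewrite ?inE //.
apply/setP => v; rewrite inE.
case pv: (piece v) => [i|] /=; first by rewrite ffunE (cP i).
have bitE y : pos v = y ->
    (v \in S) = [exists u in S, (piece u == None) && (pos u == y)].
  move=> posv; apply/idP/existsP => [vS|[u /and3P[uS /eqP pu /eqP posu]]].
    by exists v; rewrite vS pv posv !eqxx.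
  by rewrite (inj v u) // pu pv posu posv.
have := pole v pv; case: eqP => [/bitE -> //|].
by move=> nz lt2; rewrite -bitE //; lia.
Qed.

(** The vertex [vtx S] depends only on the interior of [S], and toggling it preserves this interior,
    so tails and heads are matched. A tail inside the head of another tail of the same size has a
    strictly smaller interior unless the two coincide, so the size of the interior serves as
    rank. *)
Lemma reduced_betti_le_of_interior (F : fieldType) (k N p : nat) (V : finType)
    (piece : V -> option 'I_k) (pos : V -> nat) (K : {set {set V}}) :
  simplicial_complex K ->
  injective (fun v => (piece v, pos v)) ->
  (forall v, (pos v < N)%N) ->
  (forall v, piece v = None -> (pos v < 2)%N) ->
  (forall v i y, piece v = Some i -> (y <= pos v)%N ->
    exists2 w, piece w = Some i & pos w = y) ->
  (forall S v, S \in K -> v \in hull_interior piece pos S -> v |: S \in K) ->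
  (0 < #|V|)%N ->
  (reduced_betti F K p <= 4 * (4 * N) ^ k)%N.
Proof.
move=> [K0 Kdown] inj posN pole contig Kint /card_gt0P[v0 _].
pose int := hull_interior piece pos.
(* The default [v0] is taken only when the interior is empty, and such an [S] is critical. *)
pose vtx S := odflt v0 [pick v in int S].
have vtxP S : int S != set0 -> vtx S \in int S.
  case/set0Pn => v vS; rewrite /vtx; case: pickP => [//|/(_ v)].
  by rewrite vS.
have vtxE S T : int S = int T -> vtx S = vtx T by rewrite /vtx => ->.
pose tail := [set S in K | (int S != set0) && (vtx S \notin S)].
pose crit := [set S : {set V} | hull_interior piece pos S == set0].
have N0 : (0 < N)%N by apply: leq_ltn_trans (posN v0).
apply: leq_trans (card_hull_interior0 inj posN pole contig N0).
apply: (@reduced_betti_le_critical F V K tail crit p vtx (fun S => #|int S|)).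
- move=> T; rewrite inE => /and3P[TK iT vT]; split=> //.
  by apply: Kint => //; apply: vtxP.
- move=> T T'; rewrite !inE => /and3P[TK iT vT] /and3P[TK' iT' vT'] sub cT.
  have intU : int (vtx T' |: T') = int T' by apply/hull_interior_setU1/vtxP.
  have intS : int T \subset int T' by rewrite -intU; apply: hull_interiorS.
  have [intE|ne] := eqVneq (int T) (int T').
    left; apply/eqP; rewrite eqEcard cT leqnn andbT.
    apply/subsetP => u uT; have := subsetP sub u uT.
    rewrite !inE => /orP[/eqP uE|//].
    by move: vT; rewrite (vtxE _ _ intE) -uE uT.
  by right; apply: proper_card; rewrite properEneq ne.
- move=> S SK cardS.
  have [iS|iS] := eqVneq (int S) set0.
    by constructor 1; rewrite inE; apply/eqP.
  have [vS|vS] := boolP (vtx S \in S); last first.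
    by constructor 2; rewrite inE SK iS vS.
  have SE : vtx S |: (S :\ vtx S) = S by rewrite setD1K.
  have := vtxP S iS.
  case/hull_interiorP=> a [b [aS bS pa pb /andP[av vb]]].
  have aT : a \in S :\ vtx S.
    by rewrite !inE aS andbT; apply: contraTneq av => ->; rewrite ltnn.
  have bT : b \in S :\ vtx S.
    by rewrite !inE bS andbT; apply: contraTneq vb => ->; rewrite ltnn.
  have vint : vtx S \in int (S :\ vtx S).
    by apply/hull_interiorP; exists a, b; rewrite av vb.
  have intE : int (S :\ vtx S) = int S.
    by rewrite -[in RHS]SE; symmetry; apply: hull_interior_setU1.
  constructor 3; exists (S :\ vtx S); last by rewrite (vtxE _ _ intE) SE.
  rewrite inE intE iS (vtxE _ _ intE) !inE eqxx andbT /=.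
  apply: (Kdown _ _ SK); first exact: subD1set.
  by apply/set0Pn; exists a.
Qed.

Definition one_pole (k : nat) (V : finType) (piece : V -> option 'I_k)
    (S : {set V}) : Prop :=
  forall v w, v \in S -> w \in S -> piece v = None -> piece w = None -> v = w.

(* The combinatorial shape of the Cech complexes below: vertices lie on k arcs,
   or are poles (piece v = None), and a simplex meeting all arcs is cut off by
   the sum of the squared lengths of its traces on the arcs. *)
Definition arc_complex (k s : nat) (V : finType) (piece : V -> option 'I_k)
    (pos : V -> nat) (K : {set {set V}}) : Prop :=
  [/\ simplicial_complex K,
    forall S, S != set0 -> one_pole piece S ->
      (exists i, forall v, v \in S -> piece v <> Some i) -> S \in K,
    forall S (a b : 'I_k -> nat), S != set0 -> one_pole piece S ->
      (forall v i, v \in S -> piece v = Some i -> (a i <= pos v <= b i)%N) ->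
      (\sum_i (b i - a i) ^ 2 <= s)%N -> S \in K,
    forall S, S \in K -> one_pole piece S &
    forall S (a b : 'I_k -> V), S \in K ->
      (forall i, [/\ a i \in S, b i \in S, piece (a i) = Some i &
        piece (b i) = Some i]) ->
      (\sum_i (pos (b i) - pos (a i)) ^ 2 <= s)%N].

(** An interior vertex lies on an arc that [S] already meets and does not lengthen the trace there.
    If [S] misses an arc, so does the larger set; otherwise the extreme points of the traces, and
    with them the sum of squares, stay the same. *)
Lemma arc_complex_interior (k s : nat) (V : finType) (piece : V -> option 'I_k)
    (pos : V -> nat) (K : {set {set V}}) (S : {set V}) (v : V) :
  arc_complex s piece pos K ->
  (forall v, piece v = None -> (pos v < 2)%N) ->
  S \in K -> v \in hull_interior piece pos S -> v |: S \in K.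
Proof.
move=> [_ Kpart Kfull Kpole Kbound] pole SK.
case/hull_interiorP=> a [b [aS bS pa pb /andP[av vb]]].
have pv : piece v <> None.
  by move=> pv; have := pole b; rewrite pb pv => /(_ erefl); lia.
have vS0 : v |: S != set0 by apply/set0Pn; exists v; rewrite setU11.
have vSpole : one_pole piece (v |: S).
  move=> x y; rewrite !inE => /orP[/eqP ->|xS] /orP[/eqP ->|yS] // px py.
  exact: (Kpole S SK x y).
have [full|] := boolP [forall i, [exists u in S, piece u == Some i]]; last first.
  case/forallPn=> i noi; apply: Kpart => //; exists i => u.
  have noi' w : w \in S -> piece w <> Some i.
    move=> wS pw; case/negP: noi; apply/existsP; exists w.
    by rewrite wS pw eqxx.
  by rewrite !inE => /orP[/eqP ->|/noi' //]; rewrite -pa; apply: noi'.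
have ext i : exists c : V * V, [/\ c.1 \in S, c.2 \in S, piece c.1 = Some i,
    piece c.2 = Some i & forall u, u \in S -> piece u = Some i ->
    (pos c.1 <= pos u <= pos c.2)%N].
  have /existsP[u0 P0] := forallP full i.
  case: (arg_minnP (P := fun u => (u \in S) && (piece u == Some i)) pos P0).
  move=> x /andP[xS /eqP px] xmin.
  case: (arg_maxnP (P := fun u => (u \in S) && (piece u == Some i)) pos P0).
  move=> y /andP[yS /eqP py] ymax.
  exists (x, y); split=> //= u uS pu.
  by rewrite xmin ?uS ?pu //=; apply: ymax; rewrite uS pu /=.
have [c cP] := fin_all_exists ext.
apply: (Kfull _ (fun i => pos (c i).1) (fun i => pos (c i).2)) => //.
  have cS u i : u \in S -> piece u = Some i ->
      (pos (c i).1 <= pos u <= pos (c i).2)%N.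
    by move=> uS pu; have [_ _ _ _] := cP i; apply.
  move=> u i; rewrite !inE => /orP[/eqP ->|uS] pvi; last exact: cS.
  have := cS a i aS; have := cS b i bS; rewrite pa pb => /(_ pvi) + /(_ pvi).
  by lia.
apply: (Kbound S (fun i => (c i).1) (fun i => (c i).2) SK) => i.
by have [] := cP i.
Qed.

Lemma reduced_betti_arc_complex_le (F : fieldType) (k s N p : nat) (V : finType)
    (piece : V -> option 'I_k) (pos : V -> nat) (K : {set {set V}}) :
  arc_complex s piece pos K ->
  injective (fun v => (piece v, pos v)) ->
  (forall v, (pos v < N)%N) ->
  (forall v, piece v = None -> (pos v < 2)%N) ->
  (forall v i y, piece v = Some i -> (y <= pos v)%N ->
    exists2 w, piece w = Some i & pos w = y) ->
  (0 < #|V|)%N ->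
  (reduced_betti F K p <= 4 * (4 * N) ^ k)%N.
Proof.
move=> Karc inj posN pole contig V0; have [Ksc _ _ _ _] := Karc.
apply: (reduced_betti_le_of_interior F p Ksc inj posN pole contig) => // S v.
exact: (arc_complex_interior Karc pole).
Qed.

(* When #|E| = s.+1, all facets of this set are faces, but the set is not; the facets
   that still meet every arc are maximal faces. *)
Definition arc_nonface (k n : nat) (V : finType) (piece : V -> option 'I_k)
    (pos : V -> nat) (E : {set 'I_k}) (t : {ffun 'I_k -> 'I_n}) : {set V} :=
  [set v | if piece v is Some i
           then (pos v == t i) || (i \in E) && (pos v == (t i).+1)
           else false].

(** * Lower bound: cycles around non-faces *)

Section ArcLowerBound.
Context (F : fieldType) (k s n p : nat) (V : finType).
Context (piece : V -> option 'I_k) (pos : V -> nat) (K : {set {set V}}).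
Context (vx : 'I_k -> 'I_n.+1 -> V) (E : {set 'I_k}) (i0 : 'I_k) (W : {set V}).
Hypothesis Karc : arc_complex s piece pos K.
Hypothesis inj : injective (fun v => (piece v, pos v)).
Hypothesis vxP : forall i y, piece (vx i y) = Some i /\ pos (vx i y) = y.
Hypothesis i0E : i0 \in E.
Hypothesis cardE : #|E| = s.+1.

Notation Q := (arc_nonface piece pos E).

Let vx0 (t : {ffun 'I_k -> 'I_n}) i := vx i (widen_ord (leqnSn n) (t i)).
Let vx1 (t : {ffun 'I_k -> 'I_n}) i := vx i (lift ord0 (t i)).

Let vx0P t i : piece (vx0 t i) = Some i /\ pos (vx0 t i) = t i.
Proof. by have [] := vxP i (widen_ord (leqnSn n) (t i)). Qed.

Let vx1P t i : piece (vx1 t i) = Some i /\ pos (vx1 t i) = (t i).+1.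
Proof. by have [] := vxP i (lift ord0 (t i)). Qed.

Let vx0Q t i : vx0 t i \in Q t.
Proof. by rewrite inE; have [-> ->] := vx0P t i; rewrite eqxx. Qed.

Let vx1Q t i : i \in E -> vx1 t i \in Q t.
Proof. by move=> iE; rewrite inE; have [-> ->] := vx1P t i; rewrite iE eqxx orbT. Qed.

Lemma card_arc_nonface (t : {ffun 'I_k -> 'I_n}) : #|Q t| = (k + s.+1)%N.
Proof.
have -> : Q t = [set vx0 t i | i : 'I_k] :|: [set vx1 t i | i in E].
  apply/setP => v; apply/idP/setUP.
    rewrite inE; case pv: (piece v) => [i|//].
    case/orP => [/eqP posv|/andP[iE /eqP posv]]; [left|right]; apply/imsetP;
      exists i => //; apply: inj; rewrite pv posv.
      by have [-> ->] := vx0P t i.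
    by have [-> ->] := vx1P t i.
  by case=> /imsetP[i iE ->]; [apply: vx0Q|apply: vx1Q].
rewrite cardsU disjoint_setI0 ?cards0 ?subn0; last first.
  rewrite disjoint_subset; apply/subsetP => _ /imsetP[i _ ->].
  apply/imsetP => -[j _ vE]; have [p0 q0] := vx0P t i; have [p1 q1] := vx1P t j.
  by move: p0 q0; rewrite vE p1 q1 => -[->]; lia.
rewrite !card_imset ?cardE ?cardsT ?card_ord //.
  move=> i j vE; have [p0 _] := vx1P t i; have [p1 _] := vx1P t j.
  by move: p0; rewrite vE p1 => -[].
move=> i j vE; have [p0 _] := vx0P t i; have [p1 _] := vx0P t j.
by move: p0; rewrite vE p1 => -[].
Qed.

(** Removing the only point of an undoubled arc leaves an arc unmet. Removing a point of a doubled
    arc leaves [s] traces of length one, all others having length zero. *)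
Lemma arc_nonface_face (t : {ffun 'I_k -> 'I_n}) (x : V) (T : {set V}) : x \in Q t ->
  T != set0 -> one_pole piece T ->
  (forall v, piece v <> None -> (v \in T) = (v \in Q t :\ x)) -> T \in K.
Proof.
have [_ Kpart Kfull _ _] := Karc.
rewrite inE; case px: (piece x) => [i|//] xQ T0 Tpole TQ.
have [iE|niE] := boolP (i \in E); last first.
  apply: Kpart => //; exists i => v vT pv; move: vT; rewrite TQ ?pv // !inE pv.
  rewrite (negbTE niE) orbF; move: xQ; rewrite (negbTE niE) orbF => /eqP posx.
  case/andP=> nvx /eqP posv; case/eqP: nvx; apply: inj.
  by rewrite pv px posv posx.
(* On the arc of [x] both bounds are the position of the point that remains. *)
pose a j := if j == i then (if pos x == t i then (t i).+1 else t i) else t j :> nat.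
pose b j := if j == i then a j else (t j + (j \in E))%N.
apply: (Kfull _ a b) => //.
  move=> v j vT pv; move: vT; rewrite TQ ?pv // !inE pv /b /a => /andP[nvx vQ].
  case: (eqVneq j i) => [jE|_]; last by case: (j \in E) vQ => /=; lia.
  have : pos v <> pos x.
    by move=> posv; case/eqP: nvx; apply: inj; rewrite pv px jE posv.
  by move: xQ vQ; rewrite -jE; case: (j \in E); case: (pos x =P t j :> nat) => /=; lia.
rewrite -ltnS -cardE -sum1_card (bigD1 i) //= [X in (_ < X)%N](bigD1 i) //=.
rewrite /b eqxx subnn exp0n // add0n add1n ltnS big_mkcond [X in (_ <= X)%N]big_mkcond.
apply: leq_sum => j _; rewrite /a; case: (eqVneq j i) => [_|_]; rewrite ?andbF //.
by rewrite andbT addKn; case: (j \in E).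
Qed.

(** Without its lower point on [i0], the set [Q t] still meets every arc and has sum of squared
    lengths exactly [s]. Any further vertex on an arc lengthens a trace and pushes the sum above
    [s]; a further pole is excluded by the assumption on [W]. *)
Lemma arc_nonface_maximal (t : {ffun 'I_k -> 'I_n}) (v : V) :
  (forall w, w \in W -> piece w = None) ->
  (forall w, piece w = None -> w \notin W -> ~ one_pole piece (w |: W)) ->
  v \notin W :|: (Q t :\ vx0 t i0) -> v |: (W :|: (Q t :\ vx0 t i0)) \notin K.
Proof.
move=> Wpole Wmax; have [_ _ _ Kpole Kbound] := Karc.
set G := W :|: _; rewrite !inE negb_or => /andP[vW vQ].
case pv: (piece v) => [i|]; last first.
  apply/negP => /Kpole vG; apply: (Wmax v pv vW) => x y xW yW.
  have sub w : w \in v |: W -> w \in v |: G.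
    by rewrite !inE => /orP[->|->]; rewrite ?orbT.
  by move=> px py; apply: vG => //; apply: sub.
have inG w : piece w <> None -> w != vx0 t i0 -> w \in Q t -> w \in v |: G.
  by move=> _ w0 wQ; rewrite !inE w0; move: wQ; rewrite inE => ->; rewrite !orbT.
have vx0G j : j != i0 -> vx0 t j \in v |: G.
  move=> j0; apply: inG => //; first by have [->] := vx0P t j.
  apply: contraNneq j0 => vE; have [p0 _] := vx0P t j.
  by have [p1 _] := vx0P t i0; move: p0; rewrite vE p1 => -[->].
have vx1G j : j \in E -> vx1 t j \in v |: G.
  move=> jE; apply: inG; [by have [->] := vx1P t j| |exact: vx1Q].
  apply/eqP => vE; have [p0 q0] := vx1P t j.
  have [p1 q1] := vx0P t i0; move: p0 q0; rewrite vE p1 q1 => -[->]; lia.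
have vG : v \in v |: G by rewrite setU11.
(* Arc by arc lower bounds: one for each doubled arc other than [i0], and one more on the arc of the
   new vertex, which makes [s.+1] in total. *)
have ext j : exists c : V * V, [/\ c.1 \in v |: G, c.2 \in v |: G,
    piece c.1 = Some j, piece c.2 = Some j &
    (((j \in E) && (j != i0)) + (j == i) <= (pos c.2 - pos c.1) ^ 2)%N].
  have [p0 q0] := vx0P t j; have [p1 q1] := vx1P t j.
  have vQ' : piece v = Some j -> j != i0 \/ pos v != t j ->
      (pos v == t j) || (j \in E) && (pos v == (t j).+1) -> False.
    move=> pvj jv vQj; move: vQ; rewrite pvj vQj andbT => /negPn/eqP vE.
    move: pvj jv; rewrite vE; have [-> ->] := vx0P t i0 => -[->].
    by rewrite !eqxx => -[].
  have sq1 (m : nat) : (1 <= m -> 1 <= m ^ 2)%N by rewrite expn_gt0 => ->.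
  have sq2 (m : nat) : (2 <= m -> 2 <= m ^ 2)%N.
    by rewrite -mulnn; nia.
  have [jE|njE] := boolP (j \in E); last first.
    have j0 : j != i0 by apply: contraNneq njE => ->.
    have [ji|nji] := eqVneq j i; last first.
      by exists (vx0 t j, vx0 t j); split; rewrite //= ?vx0G.
    rewrite -ji in pv; have {}vQ' := vQ' pv (or_introl j0).
    have [lt|ge] := ltnP (pos v) (t j).
      exists (v, vx0 t j); split; rewrite //= ?vx0G // q0 sq1 //; lia.
    exists (vx0 t j, v); split; rewrite //= ?vx0G // q0 sq1 //.
    have e0 : pos v <> t j by move=> e; apply: vQ'; rewrite e eqxx.
    by move: ge e0; lia.
  have [j0|nj0] := eqVneq j i0 => /=; last first.
    have [ji|nji] := eqVneq j i; last first.
      exists (vx0 t j, vx1 t j); split; rewrite //= ?vx0G ?vx1G // q0 q1 sq1 //.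
      by lia.
    rewrite -ji in pv; have {}vQ' := vQ' pv (or_introl nj0).
    have [lt|ge] := ltnP (pos v) (t j).
      exists (v, vx1 t j); split; rewrite //= ?vx1G // q1 sq2 //; lia.
    exists (vx0 t j, v); split; rewrite //= ?vx0G // q0 sq2 //.
    have e0 : pos v <> t j by move=> e; apply: vQ'; rewrite e eqxx.
    have e1 : pos v <> (t j).+1 by move=> e; apply: vQ'; rewrite jE e eqxx orbT.
    by move: ge e0 e1; lia.
  have [ji|nji] := eqVneq j i; last first.
    by exists (vx1 t j, vx1 t j); split; rewrite //= ?vx1G.
  rewrite -ji in pv.
  have [lt|ge] := ltnP (pos v) (t j).+1.
    exists (v, vx1 t j); split; rewrite //= ?vx1G // q1 sq1 //; lia.
  exists (vx1 t j, v); split; rewrite //= ?vx1G // q1 sq1 //.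
  have e1 : pos v <> (t j).+1.
    move=> e; apply: (vQ' pv); first by right; rewrite e gtn_eqF.
    by rewrite e jE eqxx orbT.
  by move: ge e1; lia.
have [c cP] := fin_all_exists ext.
apply/negP => /(Kbound _ (fun j => (c j).1) (fun j => (c j).2)) bound.
have : (\sum_j (pos (c j).2 - pos (c j).1) ^ 2 <= s)%N.
  by apply: bound => j; have [] := cP j.
apply/negP; rewrite -ltnNge -cardE.
have -> : #|E| = (\sum_j (((j \in E) && (j != i0)) + (j == i)))%N.
  rewrite (cardsD1 i0 E) i0E addnC big_split /=; congr (_ + _)%N.
    rewrite -sum1_card big_mkcond; apply: eq_bigr => j _.
    by rewrite !inE andbC; case: (_ && _).
  by rewrite (bigD1 i) //= eqxx big1 // => j /negbTE ->.
by apply: leq_sum => j _; have [] := cP j.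
Qed.

(** If the distinguished face of [t'] occurs in the boundary of [x t], then [Q t] contains all
    points of [Q t'] except perhaps the lower one on [i0]. This forces [t' = t] off [i0], and there
    [t' i0] is [t i0] or one less; hence the cycles are triangular for the rank [t i0]. *)
Lemma arc_complex_betti_ge (x : {ffun 'I_k -> 'I_n} -> chain F V) :
  (forall w, w \in W -> piece w = None) ->
  (forall w, piece w = None -> w \notin W -> ~ one_pole piece (w |: W)) ->
  (forall t T, boundary_fun (x t) T != 0 ->
    [/\ #|T| = p.+1, one_pole piece T &
      exists2 y, y \in Q t &
        forall v, piece v <> None -> (v \in T) = (v \in Q t :\ y)]) ->
  (forall t, boundary_fun (x t) (W :|: (Q t :\ vx0 t i0)) != 0) ->
  (n ^ k <= reduced_betti F K p)%N.
Proof.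
move=> Wpole Wmax xface xdiag; have [Ksc _ _ _ _] := Karc.
rewrite -[X in (_ ^ X)%N](card_ord k) -[X in (X ^ _)%N](card_ord n) -card_ffun.
apply: (reduced_betti_ge_maximal_faces
  (face := fun t => W :|: (Q t :\ vx0 t i0)) (rk := fun t => t i0) Ksc _ _ xdiag).
- move=> t T /xface[cardT Tpole [y yQ TQ]]; split=> //.
  apply: (arc_nonface_face yQ _ Tpole TQ).
  by rewrite -card_gt0 cardT.
- by move=> t v; apply: arc_nonface_maximal.
move=> t t' /xface[_ _ [y _ TQ]].
have inQ v : piece v <> None -> v \in Q t' -> v != vx0 t' i0 -> v \in Q t.
  move=> pv vQ v0; have := TQ v pv.
  rewrite in_setU in_setD1 v0 vQ orbT => /esym.
  by rewrite in_setD1 => /andP[].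
have t1 j : j \in E -> t' j = t j :> nat \/ (t' j).+1 = t j.
  move=> jE; have [pj qj] := vx1P t' j.
  have : vx1 t' j \in Q t.
    apply: inQ; rewrite ?pj //; first exact: vx1Q.
    apply/eqP => vE; have [p0 q0] := vx0P t' i0; move: pj qj.
    by rewrite vE p0 q0 => -[->]; lia.
  rewrite inE pj qj jE eqSS => /orP[/eqP|/eqP]; first by right.
  by left.
have t0 j : j != i0 -> t' j = t j.
  move=> j0; apply: val_inj => /=; have [pj qj] := vx0P t' j.
  have : vx0 t' j \in Q t.
    apply: inQ; rewrite ?pj //.
    apply/eqP => vE; have [p0 q0] := vx0P t' i0; move: pj.
    by rewrite vE p0 => -[j0E]; rewrite j0E eqxx in j0.
  rewrite inE pj qj; case jE: (j \in E); last by rewrite orbF => /eqP.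
  by have := t1 j jE; case=> [-> //|]; case: eqP => //=; lia.
case: (t1 i0 i0E) => [ti0|ti0]; last by right; rewrite -ti0.
left; apply/ffunP => j; have [->|/t0 //] := eqVneq j i0.
by apply: val_inj.
Qed.

(** The cycle is the boundary of the full simplex on [Q t]. This simplex has [k + s + 1] vertices,
    so its facets have [k + s = p + 1]. *)
Lemma arc_complex_betti_ge_no_pole :
  (forall v, piece v <> None) -> W = set0 -> p.+1 = (k + s)%N ->
  (n ^ k <= reduced_betti F K p)%N.
Proof.
move=> nopole W0 pE.
apply: (@arc_complex_betti_ge (fun t => simplex_chain F (Q t))).
- by move=> w; rewrite W0 inE.
- by move=> w pw; case: (nopole w pw).
- move=> t T /boundary_simplex_neq0[y yT yQ]; split.
  + have := card_arc_nonface t; rewrite -yQ cardsU1 yT.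
    by rewrite pE; lia.
  + by move=> v w _ _ pv; case: (nopole v pv).
  exists y; first by rewrite -yQ setU11.
  move=> v _; rewrite -yQ !inE; case: eqVneq => //= ->.
  exact/negbTE.
move=> t; rewrite W0 set0U -[X in simplex_chain F X](setD1K (vx0Q t i0)).
by rewrite boundary_simplex_setU1 ?incidence_sign_neq0 // !inE eqxx.
Qed.

(** The two cones over [Q t], with the poles as apexes, are combined with signs that cancel their
    common facet [Q t]. The boundary of the result is the suspension of the boundary of [Q t], and
    each of its simplices contains exactly one pole. *)
Lemma arc_complex_betti_ge_two_poles (w0 w1 : V) :
  piece w0 = None -> piece w1 = None -> w0 != w1 ->
  (forall v, piece v = None -> v = w0 \/ v = w1) ->
  W = [set w0] -> p = (k + s)%N ->
  (n ^ k <= reduced_betti F K p)%N.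
Proof.
move=> pw0 pw1 w01 poles W0 pE.
have poleQ (t : {ffun 'I_k -> 'I_n}) w : piece w = None -> w \notin Q t.
  by move=> pw; rewrite inE pw.
have faceQ (t : {ffun 'I_k -> 'I_n}) w T : piece w = None -> T != Q t ->
    boundary_fun (simplex_chain F (w |: Q t)) T != 0 ->
    exists2 y, y \in Q t & T = w |: (Q t :\ y).
  move=> pw TQ /boundary_simplex_neq0[y yT yQ].
  have yw : y != w.
    apply: contraNneq TQ => yw; apply/eqP/setP => v.
    move/setP: yQ => /(_ v); rewrite yw in_setU1 [in RHS]in_setU1.
    case: eqVneq => [->|//] _; rewrite (negbTE (poleQ t w pw)).
    by rewrite -yw (negbTE yT).
  have yQt : y \in Q t.
    by have := setU11 y T; rewrite yQ in_setU1 (negbTE yw).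
  exists y => //; apply/setP => v; move/setP: yQ => /(_ v).
  rewrite !in_setU1 in_setD1; case: (eqVneq v y) => [->|//].
  by rewrite (negbTE yT) (negbTE yw).
pose x (t : {ffun 'I_k -> 'I_n}) : chain F V :=
  incidence_sign F w0 (Q t) *: simplex_chain F (w0 |: Q t) -
  incidence_sign F w1 (Q t) *: simplex_chain F (w1 |: Q t).
have xE (t : {ffun 'I_k -> 'I_n}) T : boundary_fun (x t) T =
    incidence_sign F w0 (Q t) * boundary_fun (simplex_chain F (w0 |: Q t)) T -
    incidence_sign F w1 (Q t) * boundary_fun (simplex_chain F (w1 |: Q t)) T.
  rewrite [LHS]ffunE ![boundary_fun (simplex_chain _ _) _]ffunE !mulr_sumr -sumrB.
  apply: eq_bigr => v _; rewrite !ffunE mulrBr.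
  by congr (_ - _); rewrite mulrCA.
have xQ (t : {ffun 'I_k -> 'I_n}) : boundary_fun (x t) (Q t) = 0.
  rewrite xE !boundary_simplex_setU1 ?poleQ //.
  by rewrite -!expr2 !sqrr_sign subrr.
apply: (@arc_complex_betti_ge x).
- by move=> w; rewrite W0 inE => /eqP ->.
- move=> w /poles[] ->; rewrite W0 ?set11 // => _ /(_ w0 w1).
  by rewrite !inE !eqxx orbT => /(_ isT isT pw0 pw1) /eqP; apply/negP.
- move=> t T xT; have TQ : T != Q t.
    by apply: contraNneq xT => ->; rewrite xQ.
  have [w pw [y yQ TE]] : exists2 w, piece w = None &
      exists2 y, y \in Q t & T = w |: (Q t :\ y).
    have [b0|b0] := eqVneq (boundary_fun (simplex_chain F (w0 |: Q t)) T) 0.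
      exists w1 => //; apply: faceQ => //; move: xT; rewrite xE b0 mulr0 add0r.
      by rewrite oppr_eq0 mulf_eq0 negb_or => /andP[].
    by exists w0 => //; apply: faceQ.
  have wQ : w \notin Q t :\ y by rewrite in_setD1 (negbTE (poleQ t w pw)) andbF.
  split.
  + rewrite TE cardsU1 wQ; have := card_arc_nonface t.
    by rewrite (cardsD1 y) yQ pE; lia.
  + have poleT v : v \in T -> piece v = None -> v = w.
      rewrite TE in_setU1 in_setD1 => /orP[/eqP //|/andP[_ vQ] pv].
      by rewrite (negbTE (poleQ t v pv)) in vQ.
    by move=> u v uT vT pu pv; rewrite (poleT u) // (poleT v).
  exists y => // v pv; rewrite TE in_setU1; case: eqVneq => // vw.
  by rewrite vw pw in pv.
move=> t; rewrite xE W0.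
have yE : w0 |: Q t = vx0 t i0 |: (w0 |: (Q t :\ vx0 t i0)).
  by rewrite setUCA setD1K.
have yT : vx0 t i0 \notin w0 |: (Q t :\ vx0 t i0).
  rewrite in_setU1 in_setD1 eqxx orbF; apply/eqP => vE.
  by have := poleQ t w0 pw0; rewrite -vE vx0Q.
rewrite {1}yE boundary_simplex_setU1 //.
have [->|/boundary_simplex_neq0[y _ yQ]] := eqVneq
    (boundary_fun (simplex_chain F (w1 |: Q t)) (w0 |: Q t :\ vx0 t i0)) 0.
  by rewrite mulr0 subr0 mulf_neq0 // incidence_sign_neq0.
have : w0 \in w1 |: Q t by rewrite -yQ !in_setU1 eqxx orbT.
by rewrite in_setU1 (negbTE w01) (negbTE (poleQ t w0 pw0)).
Qed.

End ArcLowerBound.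

(** * Geometry of the arcs *)

Definition normsq (R : realType) (d : nat) (x : 'rV[R]_d) : R :=
  \sum_i x 0 i ^+ 2.

Lemma euclidean_dist_le (R : realType) (d : nat) (x y : 'rV[R]_d) (r : R) :
  0 <= r -> (euclidean_dist x y <= r) = (normsq (x - y) <= r ^+ 2).
Proof.
move=> r0; rewrite /euclidean_dist -[in LHS](ger0_norm r0) -sqrtr_sqr.
rewrite ler_psqrt ?nnegrE ?sqr_ge0 ?sumr_ge0 // => [|i _]; last exact: sqr_ge0.
by congr (_ <= _); apply: eq_bigr => i _; rewrite !mxE.
Qed.

(* The barycentre minimises the sum of squared distances to a family (here the
   family x followed by y, of 2 n points). *)
Lemma sum_normsq_ge (R : realType) (d n : nat) (x y : 'I_n -> 'rV[R]_d)
    (c : 'rV[R]_d) :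
  (n.*2)%:R * (\sum_i (normsq (x i) + normsq (y i))) -
    normsq (\sum_i (x i + y i)) <=
  (n.*2)%:R * \sum_i (normsq (c - x i) + normsq (c - y i)).
Proof.
rewrite lerBlDr -subr_ge0.
(* [f] is [n.*2] times the displacement of [c] from the barycentre; its squared norm is the defect
   of the inequality. *)
pose f l := (n.*2)%:R * c 0 l - \sum_i (x i + y i) 0 l.
suff -> : (n.*2)%:R * (\sum_i (normsq (c - x i) + normsq (c - y i))) +
    normsq (\sum_i (x i + y i)) -
    (n.*2)%:R * (\sum_i (normsq (x i) + normsq (y i))) = \sum_l f l ^+ 2.
  by apply: sumr_ge0 => l _; apply: sqr_ge0.
have swap (u v : 'I_n -> 'rV[R]_d) : \sum_i (normsq (u i) + normsq (v i)) =
    \sum_l \sum_i (u i 0 l ^+ 2 + v i 0 l ^+ 2).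
  by rewrite exchange_big; apply: eq_bigr => i _; rewrite big_split.
rewrite (swap (fun i => c - x i) (fun i => c - y i)) swap /normsq.
rewrite !mulr_sumr -big_split /= -sumrB; apply: eq_bigr => l _.
have -> : \sum_i ((c - x i) 0 l ^+ 2 + (c - y i) 0 l ^+ 2) =
    (n.*2)%:R * c 0 l ^+ 2 - 2 * c 0 l * (\sum_i (x i + y i) 0 l) +
    \sum_i (x i 0 l ^+ 2 + y i 0 l ^+ 2).
  have -> : (n.*2)%:R * c 0 l ^+ 2 = \sum_(i < n) 2 * c 0 l ^+ 2.
    by rewrite sumr_const card_ord -mul2n natrM -[RHS]mulr_natr; ring.
  rewrite mulr_sumr -sumrB -big_split; apply: eq_bigr => i _ /=.
  by rewrite !mxE; ring.
by rewrite /f summxE; ring.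
Qed.

(** The point of R^k with all coordinates equal to this number [a] completes the k basis vectors to
    a regular simplex: its squared distance 1 - 2 a + k a^2 to each of them is 2 by
    [simplex_coordE]. The centroid, subtracted in [embed], has all coordinates (1 + a) / (k + 1). *)
Definition simplex_coord (R : realType) (k : nat) : R :=
  - (1 + Num.sqrt k.+1%:R)^-1.

Lemma simplex_coordE (R : realType) (k : nat) :
  k%:R * simplex_coord R k ^+ 2 = 1 + 2 * simplex_coord R k.
Proof.
rewrite /simplex_coord; set q := Num.sqrt _.
have q0 : 0 <= q by apply: sqrtr_ge0.
have q1 : 1 + q != 0 by apply: lt0r_neq0; lra.
have -> : k%:R = q ^+ 2 - 1 :> R by rewrite sqr_sqrtr ?ler0n // -natr1 addrK.
by field.
Qed.

(** The two sides differ by a multiple of the relation assumed for [a]. In [normsq_embed] it turns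
    the coordinates into the quadratic form of the Gram matrix. *)
Lemma simplex_coord_identity (R : realType) (a x G K : R) : K != 0 ->
  (K - 1) * a ^+ 2 = 1 + 2 * a ->
  2 * (a * x - (1 + a) / K * G) * (G - x) +
    (K - 1) * (a * x - (1 + a) / K * G) ^+ 2 = x ^+ 2 - G ^+ 2 / K.
Proof.
move=> K0 aE; apply/eqP; rewrite -subr_eq0; apply/eqP.
transitivity (((K - 1) * a ^+ 2 - (1 + 2 * a)) * (x - G / K) ^+ 2).
  by field.
by rewrite aE subrr mul0r.
Qed.

(* g |-> sum_j g_j u_j, where u_0, ..., u_k is a regular simplex of R^k with
   Gram matrix (i == j) - 1 / (k + 1); z fills k + 1 further coordinates and h
   one more, which exists only if 0 < e. *)
Definition embed (R : realType) (k e : nat) (g z : 'I_k.+1 -> R) (h : R) :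
    'rV[R]_(k + (k.+1 + e)) :=
  row_mx (\row_m (g (lift ord0 m) + simplex_coord R k * g ord0 -
                  (1 + simplex_coord R k) / k.+1%:R * \sum_j g j))
    (row_mx (\row_j z j) (\row_l (h *+ (l == 0 :> nat)))).

Lemma normsq_row_mx (R : realType) (m n : nat) (u : 'rV[R]_m) (v : 'rV[R]_n) :
  normsq (row_mx u v) = normsq u + normsq v.
Proof.
rewrite /normsq big_split_ord; congr (_ + _); apply: eq_bigr => i _.
  by rewrite row_mxEl.
by rewrite row_mxEr.
Qed.

Lemma normsq_embed (R : realType) (k e : nat) (g z : 'I_k.+1 -> R) (h : R) :
  normsq (embed e g z h) =
  \sum_j g j ^+ 2 - (\sum_j g j) ^+ 2 / k.+1%:R + \sum_j z j ^+ 2 +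
  h ^+ 2 *+ (0 < e)%N.
Proof.
rewrite /embed !normsq_row_mx addrA; congr (_ + _ + _); last first.
- case: e => [|e]; rewrite /normsq ?big_ord0 // big_ord_recl mxE /= big1 ?addr0 //.
  by move=> i _; rewrite mxE /= mulr0n expr0n.
- by apply: eq_bigr => j _; rewrite mxE.
set a := simplex_coord R k; set G := \sum_j g j.
have gE : \sum_(m < k) g (lift ord0 m) = G - g ord0.
  by rewrite /G big_ord_recl addrC addKr.
have k0 : k.+1%:R != 0 :> R by rewrite pnatr_eq0.
have aE : k%:R * a ^+ 2 = 1 + 2 * a := simplex_coordE R k.
rewrite [\sum_j g j ^+ 2]big_ord_recl.
pose b := a * g ord0 - (1 + a) / k.+1%:R * G.
have -> : normsq (\row_m (g (lift ord0 m) + a * g ord0 - (1 + a) / k.+1%:R * G))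
    = \sum_(m < k) g (lift ord0 m) ^+ 2 + 2 * b * (G - g ord0) + k%:R * b ^+ 2.
  have -> : k%:R * b ^+ 2 = \sum_(m < k) b ^+ 2.
    by rewrite sumr_const card_ord mulr_natl.
  rewrite -gE [2 * b * _]mulr_sumr -!big_split.
  by apply: eq_bigr => m _ /=; rewrite mxE /b; ring.
suff bE : 2 * b * (G - g ord0) + k%:R * b ^+ 2 =
    g ord0 ^+ 2 - G ^+ 2 / k.+1%:R by rewrite -addrA bE /=; ring.
have kE : k%:R = k.+1%:R - 1 :> R by rewrite -natr1 addrK.
rewrite /b kE; apply: simplex_coord_identity => //.
by rewrite -kE.
Qed.

Lemma embedB (R : realType) (k e : nat) (g z g' z' : 'I_k.+1 -> R) (h h' : R) :
  embed e g z h - embed e g' z' h' =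
  embed e (fun j => g j - g' j) (fun j => z j - z' j) (h - h').
Proof.
rewrite /embed !opp_row_mx !add_row_mx; congr row_mx; last congr row_mx;
  apply/rowP => l; rewrite !mxE ?mulrnBl //.
by rewrite sumrB; ring.
Qed.

Lemma embedD (R : realType) (k e : nat) (g z g' z' : 'I_k.+1 -> R) (h h' : R) :
  embed e g z h + embed e g' z' h' =
  embed e (fun j => g j + g' j) (fun j => z j + z' j) (h + h').
Proof.
rewrite /embed !add_row_mx; congr row_mx; last congr row_mx;
  apply/rowP => l; rewrite !mxE ?mulrnDl //.
by rewrite big_split /=; ring.
Qed.

Lemma embed_sum (R : realType) (k e : nat) (I : finType)
    (g z : I -> 'I_k.+1 -> R) (h : I -> R) :
  \sum_i embed e (g i) (z i) (h i) =
  embed e (fun j => \sum_i g i j) (fun j => \sum_i z i j) (\sum_i h i).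
Proof.
apply/rowP => l; rewrite summxE /embed.
case: (split_ordP l) => m ->.
  rewrite row_mxEl mxE; under eq_bigr do rewrite row_mxEl mxE.
  by rewrite sumrB big_split /= exchange_big /= -!mulr_sumr.
rewrite row_mxEr; under eq_bigr do rewrite row_mxEr.
case: (split_ordP m) => j ->.
  by rewrite row_mxEl mxE; apply: eq_bigr => i _; rewrite row_mxEl mxE.
by rewrite row_mxEr mxE -sumrMnl; apply: eq_bigr => i _; rewrite row_mxEr mxE.
Qed.

(* The factor 1 - (eps y)^2 / 2 bends the arc so that all simplices with one
   vertex on each arc have the same circumradius up to O(eps^4). *)
Definition arc_point (R : realType) (k e : nat) (eps : R) (i : 'I_k.+1) (y : nat) :
    'rV[R]_(k + (k.+1 + e)) :=
  embed e (fun j => (1 - (eps * y%:R) ^+ 2 / 2) * (j == i)%:R)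
    (fun j => eps * y%:R * (j == i)%:R) 0.

Definition pole_point (R : realType) (k e : nat) (h : R) :
    'rV[R]_(k + (k.+1 + e)) := embed e (fun=> 0) (fun=> 0) h.

(* 1 - 1 / (k + 1) is the squared circumradius of the simplex, and a simplex with
   sum D of squared lengths needs eps^2 D / (4 (k + 1)^2) more, up to O(eps^4): the
   choice D = s + 1/2 separates D <= s from D >= s + 1. *)
Definition arc_radius2 (R : realType) (k s : nat) (eps : R) : R :=
  1 - k.+1%:R^-1 + eps ^+ 2 * (2 * s%:R + 1) / (8 * k.+1%:R ^+ 2).

Lemma sum_sub_delta (R : realType) (k : nat) (g : 'I_k -> R) (a : R) (i : 'I_k) :
  \sum_j (g j - a * (j == i)%:R) = \sum_j g j - a.
Proof.
rewrite sumrB; congr (_ - _); rewrite (bigD1 i) //= eqxx mulr1 big1 ?addr0 //.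
by move=> j /negbTE ->; rewrite mulr0.
Qed.

Lemma sum_sqr_sub_delta (R : realType) (k : nat) (g : 'I_k -> R) (a : R) (i : 'I_k) :
  \sum_j (g j - a * (j == i)%:R) ^+ 2 = \sum_j g j ^+ 2 - 2 * a * g i + a ^+ 2.
Proof.
rewrite (bigD1 i) //= eqxx [in RHS](bigD1 i) //=.
rewrite (eq_bigr (fun j => g j ^+ 2)) => [|j /negbTE ->]; first by ring.
by rewrite mulr0 subr0.
Qed.

Lemma normsq_sub_arc_point (R : realType) (k e : nat) (eps : R)
    (g z : 'I_k.+1 -> R) (h : R) (i : 'I_k.+1) (y : nat) :
  normsq (embed e g z h - arc_point e eps i y) =
  \sum_j g j ^+ 2 - 2 * (1 - (eps * y%:R) ^+ 2 / 2) * g i +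
  (1 - (eps * y%:R) ^+ 2 / 2) ^+ 2 -
  (\sum_j g j - (1 - (eps * y%:R) ^+ 2 / 2)) ^+ 2 / k.+1%:R +
  (\sum_j z j ^+ 2 - 2 * (eps * y%:R) * z i + (eps * y%:R) ^+ 2) +
  h ^+ 2 *+ (0 < e)%N.
Proof.
by rewrite embedB normsq_embed !sum_sqr_sub_delta sum_sub_delta subr0.
Qed.

Lemma normsq_sub_pole_point (R : realType) (k e : nat) (g z : 'I_k.+1 -> R)
    (h h' : R) :
  normsq (embed e g z h - pole_point k e h') =
  \sum_j g j ^+ 2 - (\sum_j g j) ^+ 2 / k.+1%:R + \sum_j z j ^+ 2 +
  (h - h') ^+ 2 *+ (0 < e)%N.
Proof.
rewrite embedB normsq_embed.
by congr (_ - _ ^+ 2 / _ + _ + _); apply: eq_bigr => j _; rewrite subr0.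
Qed.

Lemma natr_bounds (R : realType) (m L : nat) : (m <= L)%N ->
  0 <= m%:R :> R /\ m%:R <= L%:R :> R.
Proof. by move=> mL; rewrite ler0n ler_nat. Qed.

Lemma sum_bounds (R : realType) (k : nat) (f : 'I_k -> R) (B : R) :
  (forall i, 0 <= f i <= B) -> 0 <= \sum_i f i <= k%:R * B.
Proof.
move=> fB; rewrite sumr_ge0 /= => [|i _]; last by have /andP[] := fB i.
rewrite mulr_natl -[k in B *+ k]card_ord -sumr_const; apply: ler_sum => i _.
by have /andP[] := fB i.
Qed.

Lemma four_term_bound (R : realType) (x y z w B : R) :
  0 <= x <= B -> 0 <= y <= B -> 0 <= z <= B -> 0 <= w <= B ->
  `|x / 4 - y + z - w / 4| <= 2 * B.
Proof.
move=> /andP[x0 xB] /andP[y0 yB] /andP[z0 zB] /andP[w0 wB].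
by rewrite ler_norml; apply/andP; split; lra.
Qed.

Section ArcGeometry.
Context (R : realType) (k e s L : nat) (eps h : R).
Local Notation K := (k.+1%:R : R).
Local Notation P := (arc_point e eps).
Local Notation l := (L%:R : R).
Hypothesis eps_gt0 : 0 < eps.
Hypothesis L_gt0 : (0 < L)%N.
Hypothesis eps_small : eps * (32 * K ^+ 2 * l ^+ 2) <= 1.
Hypothesis h_small : h ^+ 2 *+ (0 < e)%N <= eps ^+ 2 / (16 * K ^+ 2).

Let K1 : 1 <= K. Proof. by rewrite ler1n. Qed.
Let l1 : 1 <= l. Proof. by rewrite ler1n. Qed.
Let K0 : K != 0. Proof. by rewrite pnatr_eq0. Qed.
Let iK0 : 0 < K^-1. Proof. by rewrite invr_gt0 ltr0n. Qed.
Let iK1 : K^-1 <= 1. Proof. by rewrite invf_le1 ?ltr0n. Qed.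

Let epsl : eps * l ^+ 2 <= K^-1 ^+ 2 / 32.
Proof.
have -> : eps * l ^+ 2 = (eps * (32 * K ^+ 2 * l ^+ 2)) * (K^-1 ^+ 2 / 32).
  by field; rewrite nat1r.
by rewrite ler_piMl // divr_ge0 ?sqr_ge0.
Qed.

(** Fourth-order errors are measured against this bound, which is far below the slack eps^2 / (8
    K^2) left in [arc_radius2]. *)
Let epsl4 : eps ^+ 4 * (K * l ^+ 4) <= eps ^+ 2 * (K^-1 ^+ 2 / 1024).
Proof.
have -> : eps ^+ 4 * (K * l ^+ 4) = eps ^+ 2 * (K * (eps * l ^+ 2) ^+ 2) by ring.
rewrite ler_pM2l ?exprn_gt0 //.
have -> : K^-1 ^+ 2 / 1024 = K * ((K^-1 ^+ 2 / 32) * (K^-1 / 32)) by field; rewrite nat1r.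
rewrite ler_pM2l ?ltr0n // expr2.
have el0 : 0 <= eps * l ^+ 2 by rewrite mulr_ge0 ?sqr_ge0 ?ltW.
rewrite ler_pM // (le_trans epsl) // ler_pM2r ?invr_gt0 //.
by rewrite expr2 ler_piMr // ltW.
Qed.

(** For the centre chosen below, the squared distance to [P i y] is 1 - 1/K + eps^2 ((y - a_i) (y -
    b_i) / K + S2 / (4 K^2)) plus [h ^+ 2] (if [0 < e]) and a term of order eps^4, where S2 is the
    sum of squared lengths. The product is nonpositive for y between a_i and b_i. *)
Lemma arc_face_center (a b : 'I_k.+1 -> nat) :
  (forall i, a i <= b i <= L)%N -> (\sum_i (b i - a i) ^ 2 <= s)%N ->
  exists c : 'rV[R]_(k + (k.+1 + e)),
    (forall i y, (a i <= y <= b i)%N ->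
      normsq (c - P i y) <= arc_radius2 k s eps) /\
    (forall H, normsq (c - pole_point k e H) <=
      2 * eps ^+ 2 * l ^+ 2 + (h - H) ^+ 2 *+ (0 < e)%N).
Proof.
move=> abL cost.
pose D2 i : R := (b i)%:R - (a i)%:R.
pose m i : R := ((a i)%:R + (b i)%:R) / 2.
pose S2 := \sum_i D2 i ^+ 2; pose M := \sum_i m i ^+ 2.
(* q is the second-order move of the centre that makes all arcs equally far. *)
pose q i := K^-1 * (D2 i ^+ 2 / 4 - m i ^+ 2 + K^-1 * M - K^-1 * S2 / 4) / 2.
have Dm i : 0 <= D2 i <= l /\ 0 <= m i <= l.
  have /andP[ab bL] := abL i; have [b0 bl] := natr_bounds R bL.
  have [a0 al] := natr_bounds R ab.
  by rewrite /D2 /m; split; apply/andP; split; lra.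
have D2l i : 0 <= D2 i ^+ 2 <= l ^+ 2.
  by have [/andP[D0 Dl] _] := Dm i; rewrite sqr_ge0 lerXn2r ?nnegrE ?ler0n.
have m2l i : 0 <= m i ^+ 2 <= l ^+ 2.
  by have [_ /andP[D0 Dl]] := Dm i; rewrite sqr_ge0 lerXn2r ?nnegrE ?ler0n.
have /andP[S20 S2l] := sum_bounds D2l; have /andP[M0 Ml] := sum_bounds m2l.
rewrite -/S2 in S20 S2l; rewrite -/M in M0 Ml.
have S2s : S2 <= s%:R.
  rewrite -(ler_nat R) natr_sum in cost; apply: le_trans cost.
  apply: ler_sum => i _; have /andP[ab _] := abL i.
  by rewrite natrX natrB.
have Si : 0 <= K^-1 * S2 <= l ^+ 2.
  by rewrite mulr_ge0 ?(ltW iK0) //= ler_pdivrMl ?ltr0n.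
have Mi : 0 <= K^-1 * M <= l ^+ 2.
  by rewrite mulr_ge0 ?(ltW iK0) //= ler_pdivrMl ?ltr0n.
have qb i : - l ^+ 2 <= q i <= l ^+ 2.
  rewrite -ler_norml /q; set w := (X in _ * X / 2).
  have wl : `|w| <= 2 * l ^+ 2 by apply: four_term_bound.
  rewrite -mulrA normrM (ger0_norm (ltW iK0)) normrM.
  rewrite (@ger0_norm _ 2^-1) ?invr_ge0 // -[leRHS]mul1r ler_pM // ?(ltW iK0) //.
    by rewrite divr_ge0.
  by rewrite ler_pdivrMr // mulrC.
have ql i : 0 <= q i ^+ 2 <= l ^+ 4.
  have -> : l ^+ 4 = (l ^+ 2) ^+ 2 by rewrite -exprM.
  rewrite sqr_ge0 /=.
  by rewrite -[q i ^+ 2]real_normK ?num_real // lerXn2r ?nnegrE ?sqr_ge0 // ler_norml qb.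
have /andP[Q0 Ql] := sum_bounds ql.
set Q2 := \sum_i _ in Q0 Ql.
have sumq : \sum_i q i = 0.
  have cst (x : R) : \sum_(i < k.+1) x = K * x.
    by rewrite sumr_const card_ord mulr_natl.
  rewrite /q -mulr_suml -mulr_sumr sumrB big_split sumrB /= !cst -mulr_suml -/S2 -/M.
  by field; rewrite nat1r.
(* To first order in [eps] this is the barycentre of the midpoints of the traces, lifted to height
   [h]. *)
exists (embed e (fun i => eps ^+ 2 * q i) (fun i => eps * (K^-1 * m i)) h).
have sumg : \sum_i eps ^+ 2 * q i = 0 by rewrite -mulr_sumr sumq mulr0.
have sumg2 : \sum_i (eps ^+ 2 * q i) ^+ 2 = eps ^+ 4 * Q2.
  by rewrite mulr_sumr; apply: eq_bigr => i _; rewrite exprMn -exprM.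
have sumz2 : \sum_i (eps * (K^-1 * m i)) ^+ 2 = eps ^+ 2 * (K^-1 ^+ 2 * M).
  by rewrite /M !mulr_sumr; apply: eq_bigr => i _; rewrite !exprMn.
split=> [i y|H].
  move=> /andP[ay yb]; rewrite normsq_sub_arc_point sumg sumg2 sumz2.
  have /andP[_ bL] := abL i.
  have [y0 yl] := natr_bounds R (leq_trans yb bL).
  have hs := h_small.
  set hh := h ^+ 2 *+ _ in hs *; set Y := y%:R in y0 yl *.
  have -> : eps ^+ 4 * Q2 - 2 * (1 - (eps * Y) ^+ 2 / 2) * (eps ^+ 2 * q i) +
      (1 - (eps * Y) ^+ 2 / 2) ^+ 2 -
      (0 - (1 - (eps * Y) ^+ 2 / 2)) ^+ 2 / K +
      (eps ^+ 2 * (K^-1 ^+ 2 * M) - 2 * (eps * Y) * (eps * (K^-1 * m i)) +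
       (eps * Y) ^+ 2) + hh =
      1 - K^-1 + eps ^+ 2 * (K^-1 * ((Y - (a i)%:R) * (Y - (b i)%:R)) +
        K^-1 ^+ 2 * S2 / 4) +
      eps ^+ 4 * (Q2 + q i * Y ^+ 2 + (1 - K^-1) * Y ^+ 4 / 4) + hh.
    by rewrite /q /D2 /m; field; rewrite nat1r.
  have Y2 : Y ^+ 2 <= l ^+ 2 by rewrite lerXn2r ?nnegrE ?ler0n.
  have Y4 : Y ^+ 4 <= l ^+ 4 by rewrite lerXn2r ?nnegrE ?ler0n.
  have l4 : l ^+ 4 <= K * l ^+ 4 by rewrite ler_peMl ?exprn_ge0 ?ler0n.
  have bracket : Q2 + q i * Y ^+ 2 + (1 - K^-1) * Y ^+ 4 / 4 <= 3 * (K * l ^+ 4).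
    have h1 : q i * Y ^+ 2 <= l ^+ 4.
      have -> : l ^+ 4 = l ^+ 2 * l ^+ 2 by rewrite -exprD.
      apply: (@le_trans _ _ (l ^+ 2 * Y ^+ 2)).
        by rewrite ler_wpM2r ?sqr_ge0 //; have /andP[] := qb i.
      by rewrite ler_wpM2l ?sqr_ge0.
    have h2 : (1 - K^-1) * Y ^+ 4 <= Y ^+ 4.
      by rewrite ler_piMl ?exprn_ge0 // lerBlDr lerDl ltW.
    have l40 : 0 <= l ^+ 4 by rewrite exprn_ge0 ?ler0n.
    clear -Ql h1 h2 Y4 l4 l40; move: Ql h1 h2 Y4 l4 l40.
    set x1 := q i * _; set x2 := (1 - _) * _; set x3 := K * _.
    by lra.
  have lead : K^-1 * ((Y - (a i)%:R) * (Y - (b i)%:R)) + K^-1 ^+ 2 * S2 / 4 <=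
      K^-1 ^+ 2 * s%:R / 4.
    rewrite -[leRHS]add0r lerD //.
      by rewrite mulr_ge0_le0 ?(ltW iK0) // mulr_ge0_le0 ?subr_ge0 ?subr_le0 ?ler_nat.
    by rewrite ler_pM2r ?invr_gt0 // ler_wpM2l ?sqr_ge0.
  have eps2 : 0 < eps ^+ 2 by rewrite exprn_gt0.
  have eps4 : 0 < eps ^+ 4 by rewrite exprn_gt0.
  have := ler_wpM2l (ltW eps2) lead; have := ler_wpM2l (ltW eps4) bracket.
  (* In units of eps^2 / (1024 K^2), the slack in the radius is 128; the height takes at most 64 and
     the fourth-order terms at most 3. *)
  have tE : eps ^+ 2 / (16 * K ^+ 2) = eps ^+ 2 * (K^-1 ^+ 2 / 1024) * 64.
    by field; rewrite nat1r.
  have rE : eps ^+ 2 * (2 * s%:R + 1) / (8 * K ^+ 2) =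
      eps ^+ 2 * (K^-1 ^+ 2 * s%:R / 4) + eps ^+ 2 * (K^-1 ^+ 2 / 1024) * 128.
    by field; rewrite nat1r.
  have t0 : 0 <= eps ^+ 2 * (K^-1 ^+ 2 / 1024).
    by apply: mulr_ge0; [exact: sqr_ge0|apply: divr_ge0; rewrite ?sqr_ge0].
  rewrite /arc_radius2 rE; rewrite tE in hs; move: epsl4 hs t0.
  rewrite [eps ^+ 4 * (3 * _)]mulrCA.
  set x1 := eps ^+ 4 * (K * _); set x2 := eps ^+ 2 * (_ / 1024).
  set x3 := eps ^+ 4 * (Q2 + _ + _); set x4 := eps ^+ 2 * (_ * s%:R / 4).
  set x5 := eps ^+ 2 * (K^-1 * _ + _).
  by move: (K^-1) x1 x2 x3 x4 x5 hh => iK x1 x2 x3 x4 x5 hh; lra.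
rewrite normsq_sub_pole_point sumg sumg2 sumz2 lerD2r.
have e1 : eps ^+ 4 * Q2 <= eps ^+ 2 * l ^+ 2.
  apply: (le_trans (ler_wpM2l _ Ql)); first by rewrite exprn_ge0 ?ltW.
  apply: (le_trans epsl4); rewrite ler_pM2l ?exprn_gt0 //.
  have : K^-1 ^+ 2 <= 1 by rewrite exprn_ile1 // ltW.
  have : 1 <= l ^+ 2 by rewrite exprn_ege1.
  by move: (K^-1 ^+ 2) (l ^+ 2) => u v; lra.
have e2 : eps ^+ 2 * (K^-1 ^+ 2 * M) <= eps ^+ 2 * l ^+ 2.
  rewrite ler_pM2l ?exprn_gt0 // expr2 -mulrA.
  have /andP[M0' Ml'] := Mi.
  by apply: (le_trans _ Ml'); rewrite ler_piMl.
rewrite expr0n /= mul0r subr0 -mulrA [2 * _]mulr_natl mulr2n.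
exact: lerD.
Qed.

(* The centre moves away from the arc i0, which the simplex does not meet. *)
Lemma arc_coface_center (i0 : 'I_k.+1) :
  exists c : 'rV[R]_(k + (k.+1 + e)),
    (forall i y, i != i0 -> (y <= L)%N ->
      normsq (c - P i y) <= arc_radius2 k s eps) /\
    (forall H, normsq (c - pole_point k e H) <=
      2 * eps ^+ 2 * l ^+ 2 + (h - H) ^+ 2 *+ (0 < e)%N).
Proof.
exists (embed e (fun j => 0 - eps * (j == i0)%:R) (fun=> 0) h).
have z0 : \sum_(j < k.+1) (0 : R) = 0 by rewrite big1.
have z20 : \sum_(j < k.+1) (0 : R) ^+ 2 = 0.
  by rewrite big1 // => j _; rewrite expr0n.
have el : eps <= eps * l ^+ 2 by rewrite ler_peMr ?exprn_ege1 // ltW.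
have e10 : eps * l ^+ 2 <= 1 / 32.
  by apply: (le_trans epsl); rewrite ler_pM2r ?invr_gt0 // exprn_ile1 // ltW.
have e2l : eps ^+ 2 * l ^+ 2 <= eps * K^-1 / 32.
  rewrite -[leRHS]mulrA expr2 -mulrA ler_pM2l //; apply: (le_trans epsl).
  by rewrite ler_pM2r ?invr_gt0 // expr2 ler_piMr // ltW.
have e2 : eps ^+ 2 <= eps ^+ 2 * l ^+ 2.
  by rewrite ler_peMr ?exprn_ege1 ?sqr_ge0.
split=> [i y ii0 yL|H].
  rewrite normsq_sub_arc_point sum_sqr_sub_delta sum_sub_delta z0 z20.
  rewrite (negbTE ii0) !mulr0 !subr0.
  have [y0 yl] := natr_bounds R yL.
  have hs := h_small.
  set hh := h ^+ 2 *+ _ in hs *; set Y := y%:R in y0 yl *.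
  set a := 1 - (eps * Y) ^+ 2 / 2.
  have Y2 : (eps * Y) ^+ 2 <= eps ^+ 2 * l ^+ 2.
    rewrite exprMn ler_pM2l ?exprn_gt0 //.
    by rewrite lerXn2r ?nnegrE ?ler0n.
  have p0 : eps * K^-1 <= 1.
    rewrite -[leRHS]mulr1 ler_pM ?(ltW iK0) ?(ltW eps_gt0) //.
    by apply: (le_trans el); apply: (le_trans e10); rewrite ler_pdivrMr // mul1r ler1n.
  have p00 : 0 <= eps * K^-1 by rewrite mulr_ge0 ?(ltW iK0) ?(ltW eps_gt0).
  have Y20 : 0 <= (eps * Y) ^+ 2 by apply: sqr_ge0.
  have a1 : 1 / 2 <= a <= 1.
    move: e2l p0 Y2 Y20; rewrite /a.
    move: (eps * K^-1) (eps ^+ 2 * l ^+ 2) ((eps * Y) ^+ 2).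
    by move=> u v w h1 h2 h3 h4; apply/andP; split; lra.
  have p1 : (1 - K^-1) * a ^+ 2 <= 1 - K^-1.
    have /andP[a0 a2] := a1.
    by rewrite ler_piMr ?subr_ge0 // exprn_ile1 // (le_trans _ a0) // divr_ge0.
  have p2 : (1 - K^-1) * eps ^+ 2 <= eps ^+ 2.
    by rewrite ler_piMl ?sqr_ge0 // gerBl ltW.
  have p3 : eps * K^-1 * (1 / 2) <= eps * K^-1 * a.
    by rewrite ler_wpM2l //; have /andP[] := a1.
  have p4 : eps ^+ 2 / (16 * K ^+ 2) <= eps ^+ 2.
    rewrite ler_pdivrMr ?mulr_gt0 ?exprn_gt0 ?ltr0n // ler_peMr ?sqr_ge0 //.
    by rewrite mulr_ege1 ?exprn_ege1 // ler1n.
  have p5 : 0 <= eps ^+ 2 * (2 * s%:R + 1) / (8 * K ^+ 2).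
    apply: divr_ge0; apply: mulr_ge0; rewrite ?sqr_ge0 //.
    by rewrite addr_ge0 ?mulr_ge0 ?ler0n.
  rewrite /arc_radius2.
  (* The gain [2 * (eps * K^-1 * a)] is at least eps / K, while each of the three second-order terms
     is at most eps / (32 K). *)
  apply: (@le_trans _ _ ((1 - K^-1) * a ^+ 2 + (1 - K^-1) * eps ^+ 2 -
    2 * (eps * K^-1 * a) + (eps * Y) ^+ 2 + hh)).
    by rewrite le_eqVlt; apply/orP; left; apply/eqP; ring.
  move: p00 p0 p1 p2 p3 (le_trans hs p4) p5 e2 e2l Y2.
  set x1 := _ / (8 * _); set x2 := (1 - _) * a ^+ 2; set x3 := (1 - _) * eps ^+ 2.
  set x4 := eps ^+ 2 * l ^+ 2; set x5 := eps * K^-1 * a; set x6 := (eps * Y) ^+ 2.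
  set x7 := eps * K^-1; set x8 := eps ^+ 2.
  clear hs.
  by move: (K^-1) x1 x2 x3 x4 x5 x6 x7 x8 hh => iK x1 x2 x3 x4 x5 x6 x7 x8 hh; lra.
rewrite normsq_sub_pole_point sum_sqr_sub_delta sum_sub_delta z0 z20 lerD2r.
rewrite !sub0r sqrrN !mulr0 oppr0 addr0 add0r.
rewrite -mulrA [2 * _]mulr_natl mulr2n -[leLHS]addr0 lerD //.
  by apply: le_trans e2; rewrite gerBl divr_ge0 ?sqr_ge0.
by rewrite mulr_ge0 ?sqr_ge0.
Qed.

Lemma sum_delta_mul (f : 'I_k.+1 -> R) (j : 'I_k.+1) :
  \sum_i f i * (j == i)%:R = f j.
Proof.
rewrite (bigD1 j) //= eqxx mulr1 big1 ?addr0 // => i ij.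
by rewrite eq_sym (negbTE ij) mulr0.
Qed.

Lemma sum_cst_delta (f : R) (i : 'I_k.+1) : \sum_j f * (j == i)%:R = f.
Proof.
rewrite (bigD1 i) //= eqxx mulr1 big1 ?addr0 // => j ij.
by rewrite (negbTE ij) mulr0.
Qed.

Lemma sum_sqr_cst_delta (f : R) (i : 'I_k.+1) :
  \sum_j (f * (j == i)%:R) ^+ 2 = f ^+ 2.
Proof.
rewrite -[RHS](sum_cst_delta _ i); apply: eq_bigr => j _.
by case: (j == i); rewrite ?mulr1 ?mulr0 // expr0n.
Qed.

Lemma normsq_arc_point_sub (i j : 'I_k.+1) (x y : nat) :
  normsq (P i x - P j y) =
  (1 - (eps * x%:R) ^+ 2 / 2) ^+ 2 -
  2 * (1 - (eps * y%:R) ^+ 2 / 2) * ((1 - (eps * x%:R) ^+ 2 / 2) * (j == i)%:R) +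
  (1 - (eps * y%:R) ^+ 2 / 2) ^+ 2 -
  ((1 - (eps * x%:R) ^+ 2 / 2) - (1 - (eps * y%:R) ^+ 2 / 2)) ^+ 2 / K +
  ((eps * x%:R) ^+ 2 - 2 * (eps * y%:R) * (eps * x%:R * (j == i)%:R) +
   (eps * y%:R) ^+ 2).
Proof.
rewrite [P i x]/arc_point normsq_sub_arc_point !sum_cst_delta !sum_sqr_cst_delta.
by rewrite expr0n /= mul0rn addr0.
Qed.

Let eps2l : eps ^+ 2 * l ^+ 2 <= 1 / 32.
Proof.
have el : eps <= eps * l ^+ 2 by rewrite ler_peMr ?exprn_ege1 // ltW.
have e10 : eps * l ^+ 2 <= 1 / 32.
  by apply: (le_trans epsl); rewrite ler_pM2r ?invr_gt0 // exprn_ile1 // ltW.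
rewrite expr2 -mulrA -[leRHS]mul1r ler_pM ?(ltW eps_gt0) //.
  by rewrite mulr_ge0 ?sqr_ge0 ?(ltW eps_gt0).
by apply: (le_trans el); apply: (le_trans e10); rewrite ler_pdivrMr // mul1r ler1n.
Qed.

Let arc_coord_le (y : nat) : (y <= L)%N -> 0 <= (eps * y%:R) ^+ 2 <= eps ^+ 2 * l ^+ 2.
Proof.
move=> yL; have [y0 yl] := natr_bounds R yL.
rewrite sqr_ge0 exprMn /= ler_pM2l ?exprn_gt0 //.
by rewrite lerXn2r ?nnegrE ?ler0n.
Qed.

(** With [a] and [b] the bending factors, points on different arcs have squared distance at least 2
    a b > 0; on one arc the distance is at least eps |x - y|. *)
Lemma arc_point_inj (i j : 'I_k.+1) (x y : nat) : (x <= L)%N -> (y <= L)%N ->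
  P i x = P j y -> i = j /\ x = y.
Proof.
move=> /arc_coord_le/andP[x0 xl] /arc_coord_le/andP[y0 yl] Pij.
have := normsq_arc_point_sub i j x y; rewrite Pij subrr {Pij}.
have -> : normsq (0 : 'rV[R]_(k + (k.+1 + e))) = 0.
  by rewrite /normsq big1 // => m _; rewrite mxE expr0n.
set a := 1 - (eps * x%:R) ^+ 2 / 2; set b := 1 - (eps * y%:R) ^+ 2 / 2.
have ab : (a - b) ^+ 2 / K <= (a - b) ^+ 2.
  by rewrite ler_pdivrMr ?ltr0n // ler_peMr ?sqr_ge0.
have a0 : 1 / 2 <= a.
  move: xl eps2l; rewrite /a; move: (eps ^+ 2 * l ^+ 2) ((eps * x%:R) ^+ 2).
  by move=> u v; lra.
have b0 : 1 / 2 <= b.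
  move: yl eps2l; rewrite /b; move: (eps ^+ 2 * l ^+ 2) ((eps * y%:R) ^+ 2).
  by move=> u v; lra.
have [ij|ij] := eqVneq j i; rewrite ?mulr1 ?mulr0; last first.
  have ab0 : 0 < a * b by rewrite mulr_gt0 //; lra.
  move: ab ab0 x0 y0; rewrite subr0.
  rewrite (_ : (a - b) ^+ 2 = a ^+ 2 - 2 * (a * b) + b ^+ 2); last by ring.
  set u := (_ - _ + _) / K.
  move: (a ^+ 2) (b ^+ 2) (a * b) ((eps * x%:R) ^+ 2) ((eps * y%:R) ^+ 2) u.
  by move=> ? ? ? ? ? ? *; exfalso; lra.
move=> normP0; split=> //; have ex : (eps * (x%:R - y%:R)) ^+ 2 <= 0.
  move: ab normP0; rewrite (_ : (eps * (x%:R - y%:R)) ^+ 2 = (eps * x%:R) ^+ 2 -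
    2 * (eps * y%:R) * (eps * x%:R) + (eps * y%:R) ^+ 2); last by ring.
  set u := (a - b) ^+ 2 / K; set v := _ + (eps * y%:R) ^+ 2.
  rewrite -/a -/b (_ : (a - b) ^+ 2 = a ^+ 2 - 2 * b * a + b ^+ 2); last by ring.
  set w := a ^+ 2 - _ + _.
  by move: u v w => u v w *; lra.
have : (eps * (x%:R - y%:R)) ^+ 2 == 0 by rewrite eq_le ex sqr_ge0.
rewrite sqrf_eq0 mulf_eq0 (gt_eqF eps_gt0) subr_eq0 /= eqr_nat.
by move/eqP.
Qed.

(** The squared distances from [c] to the [2 * K] chosen points are at most the squared radius, and
    the barycentre inequality bounds their sum from below. Together they give D <= s + 1/2 + 1/1024
    for the sum D of squared lengths, and D is an integer. *)
Lemma arc_cost_le (a b : 'I_k.+1 -> nat) (c : 'rV[R]_(k + (k.+1 + e))) :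
  (forall i, a i <= L)%N -> (forall i, b i <= L)%N ->
  (forall i, normsq (c - P i (a i)) <= arc_radius2 k s eps) ->
  (forall i, normsq (c - P i (b i)) <= arc_radius2 k s eps) ->
  (\sum_i (b i - a i) ^ 2 <= s)%N.
Proof.
move=> aL bL ca cb.
pose X i := (eps * (a i)%:R) ^+ 2; pose Y i := (eps * (b i)%:R) ^+ 2.
pose beta i := (X i + Y i) / 2.
have cst (x : R) : \sum_(i < k.+1) x = K * x.
  by rewrite sumr_const card_ord mulr_natl.
have normP (i : 'I_k.+1) y : 1 - K^-1 + K^-1 * (eps * y%:R) ^+ 2 <= normsq (P i y).
  rewrite /arc_point normsq_embed; set u := (eps * y%:R) ^+ 2.
  rewrite !sum_cst_delta !sum_sqr_cst_delta -/u expr0n mul0rn addr0 -subr_ge0.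
  rewrite [leRHS](_ : _ = (1 - K^-1) * (u / 2) ^+ 2); last by field; rewrite nat1r.
  by rewrite mulr_ge0 ?sqr_ge0 // subr_ge0.
have sumP : \sum_i (P i (a i) + P i (b i)) =
    embed e (fun i => 2 - beta i) (fun i => eps * (a i)%:R + eps * (b i)%:R) 0.
  rewrite /arc_point big_split !embed_sum /= embedD !big1 ?addr0 //.
  congr embed; apply/funext => j; rewrite !sum_delta_mul //.
  by rewrite /beta /X /Y; field.
have := sum_normsq_ge (fun i => P i (a i)) (fun i => P i (b i)) c.
rewrite sumP normsq_embed expr0n mul0rn addr0.
rewrite sumrB cst.
have -> : \sum_i (2 - beta i) ^+ 2 =
    4 * K - 4 * \sum_i beta i + \sum_i beta i ^+ 2.
  rewrite mulr_sumr (_ : 4 * K = \sum_(i < k.+1) 4); last by rewrite cst mulrC.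
  by rewrite -sumrB -big_split; apply: eq_bigr => i _ /=; ring.
set S := \sum_i (_ + _); set Sb := \sum_i beta i; set Sb2 := \sum_i beta i ^+ 2.
set Sz := \sum_i (eps * _ + _) ^+ 2; set T := \sum_i _.
have S_ge : K * (2 * (1 - K^-1)) + K^-1 * (2 * Sb) <= S.
  rewrite -cst /Sb !mulr_sumr -big_split; apply: ler_sum => i _ /=.
  apply: le_trans (lerD (normP i (a i)) (normP i (b i))).
  by rewrite le_eqVlt; apply/orP; left; apply/eqP; rewrite /beta /X /Y; field; rewrite nat1r.
have T_le : T <= K * (2 * arc_radius2 k s eps).
  rewrite -cst; apply: ler_sum => i _; rewrite mulr_natl mulr2n; exact: lerD.
have Sb2_le : Sb2 <= eps ^+ 2 * (K^-1 ^+ 2 / 1024).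
  apply: le_trans epsl4.
  rewrite mulrCA -cst; apply: ler_sum => i _.
  have /andP[x0 xl] := arc_coord_le (aL i); have /andP[y0 yl] := arc_coord_le (bL i).
  rewrite (_ : eps ^+ 4 * l ^+ 4 = (eps ^+ 2 * l ^+ 2) ^+ 2); last by ring.
  have /andP[b0 bl] : 0 <= beta i <= eps ^+ 2 * l ^+ 2.
    move: x0 xl y0 yl; rewrite /beta /X /Y.
    move: ((eps * (a i)%:R) ^+ 2) ((eps * (b i)%:R) ^+ 2) (eps ^+ 2 * l ^+ 2).
    by move=> ? ? ? *; apply/andP; split; lra.
  by rewrite lerXn2r ?nnegrE //; apply: le_trans bl.
(* By the parallelogram identity, 2 u^2 + 2 v^2 - (u + v)^2 = (u - v)^2: here the lengths of the
   traces enter. *)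
have SzE : 4 * Sb - Sz = eps ^+ 2 * \sum_i ((b i)%:R - (a i)%:R) ^+ 2.
  rewrite /Sb /Sz !mulr_sumr -sumrB; apply: eq_bigr => i _.
  by rewrite /beta /X /Y; field.
have -> : (k.+1.*2)%:R = 2 * K by rewrite -mul2n natrM.
have -> : 4 * K - 4 * Sb + Sb2 - (K * 2 - Sb) ^+ 2 / K + Sz =
    Sb2 - K^-1 * Sb ^+ 2 + Sz by field; rewrite nat1r.
have Sb0 : 0 <= K^-1 * Sb ^+ 2 by rewrite mulr_ge0 ?sqr_ge0 ?(ltW iK0).
have K2 : 0 <= 2 * K by rewrite mulr_ge0 ?ler0n.
have := ler_wpM2l K2 S_ge; have := ler_wpM2l K2 T_le.
have -> : 2 * K * (K * (2 * arc_radius2 k s eps)) =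
    4 * K * (K - 1) + eps ^+ 2 * (s%:R + 1 / 2).
  by rewrite /arc_radius2; field; rewrite nat1r.
have -> : 2 * K * (K * (2 * (1 - K^-1)) + K^-1 * (2 * Sb)) =
    4 * K * (K - 1) + 4 * Sb by field; rewrite nat1r.
have eps2 : 0 < eps ^+ 2 by rewrite exprn_gt0.
have Sb2_le' : Sb2 <= eps ^+ 2 * (1 / 1024).
  apply: (le_trans Sb2_le); rewrite ler_pM2l // ler_pM2r ?invr_gt0 //.
  by rewrite exprn_ile1 // ltW.
set D2 := \sum_i (_ - _) ^+ 2 in SzE; move=> upT loS le.
have D2_lt : D2 < s.+1%:R.
  have -> : s.+1%:R = s%:R + 1 :> R by rewrite natr1.
  rewrite -(ltr_pM2l eps2) -SzE.
  have : eps ^+ 2 * (s%:R + 1 / 2) + eps ^+ 2 * (1 / 1024) < eps ^+ 2 * (s%:R + 1).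
    by rewrite -mulrDr ltr_pM2l //; move: (s%:R : R) => u; lra.
  move: upT loS le Sb0 Sb2_le'; clear SzE S_ge T_le Sb2_le.
  move: (eps ^+ 2 * (s%:R + 1 / 2)) (eps ^+ 2 * (1 / 1024)) (eps ^+ 2 * (s%:R + 1)).
  move: (2 * K * S) (2 * K * T) (K^-1 * Sb ^+ 2) (4 * K * (K - 1)).
  by move: Sb Sb2 Sz => ? ? ? ? ? ? ? ? ? ? *; lra.
rewrite -ltnS -(ltr_nat R); apply: le_lt_trans D2_lt.
rewrite natr_sum; apply: ler_sum => i _; rewrite natrX.
(* No order of the two points on an arc is assumed: in the wrong order the truncated difference is
   zero. *)
have [ab|/ltnW ba] := leqP (a i) (b i); first by rewrite natrB.
by rewrite (eqP ba) expr0n /= sqr_ge0.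
Qed.

End ArcGeometry.

(** * Poles and the complete configuration *)

Lemma normsq_triangle (R : realType) (d : nat) (c x y : 'rV[R]_d) :
  normsq (x - y) <= 2 * (normsq (c - x) + normsq (c - y)).
Proof.
rewrite /normsq -big_split mulr_sumr; apply: ler_sum => i _ /=.
rewrite !mxE -subr_ge0 (_ : _ - _ = (2 * c 0 i - x 0 i - y 0 i) ^+ 2).
  exact: sqr_ge0.
by ring.
Qed.

(** With h = eps / (4 K), the pole at height r + h/2 is at vertical distance r - h/2 from a centre
    at height h. The resulting gain is of first order in [eps] and outweighs the second-order
    horizontal part. *)
Lemma pole_radius_bound (R : realType) (K l eps r : R) :
  1 <= K -> 1 <= l -> 0 < eps -> eps * (32 * K ^+ 2 * l ^+ 2) = 1 ->
  1 / 2 <= r ->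
  2 * eps ^+ 2 * l ^+ 2 + (eps / (4 * K) - (r + eps / (4 * K) / 2)) ^+ 2 <= r ^+ 2.
Proof.
move=> K1 l1 eps0 epsE r12.
have K0 : 0 < K by apply: lt_le_trans K1.
have iK0 : 0 < K^-1 by rewrite invr_gt0.
have iK1 : K^-1 <= 1 by rewrite invf_le1.
pose t := eps * K^-1; have t0 : 0 < t by rewrite mulr_gt0.
have eps1 : eps <= 1.
  by rewrite -epsE ler_peMr ?(ltW eps0) // !mulr_ege1 // ?exprn_ege1 // ler1n.
have e1 : eps * l ^+ 2 <= K^-1 / 32.
  have -> : eps * l ^+ 2 = (K^-1 / 32) * K^-1 * (eps * (32 * K ^+ 2 * l ^+ 2)).
    by field; rewrite gt_eqF.
  by rewrite epsE mulr1 ler_piMr // divr_ge0 // ltW.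
have f1 : 2 * eps ^+ 2 * l ^+ 2 <= t / 16.
  have -> : 2 * eps ^+ 2 * l ^+ 2 = 2 * (eps * (eps * l ^+ 2)) by ring.
  have -> : t / 16 = 2 * (eps * (K^-1 / 32)) by rewrite /t; field; rewrite gt_eqF.
  by rewrite ler_pM2l // ler_pM2l.
have -> : eps / (4 * K) = t / 4 by rewrite /t; field; rewrite gt_eqF.
have t1 : t <= 1 by rewrite -[leRHS]mulr1 ler_pM // ltW.
have f2 : t * t <= t by rewrite ler_piMr // ltW.
have f3 : 1 / 2 * t <= r * t by rewrite ler_pM2r.
have -> : (t / 4 - (r + t / 4 / 2)) ^+ 2 = r ^+ 2 - r * t / 4 + t * t / 64 by field.
move: f1 f2 f3 t0; clear t1.
move: t (2 * eps ^+ 2 * l ^+ 2) (t * t) (r * t) (r ^+ 2).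
by move=> ? ? ? ? ? *; lra.
Qed.

(* The poles are slightly more than a diameter apart, but either of them fits
   together with every simplex whose centre is moved by h towards it. *)
Lemma arc_configuration_exists (R : realType) (k e s L : nat) (susp : bool) :
  (0 < L)%N -> (susp -> 0 < e)%N -> (susp -> 0 < k)%N ->
  exists (P : option 'I_k.+1 -> nat -> 'rV[R]_(k + (k.+1 + e))) (r : R),
  [/\ 0 <= r,
    forall p y q z, (y <= L)%N -> (z <= L)%N ->
      (p = None -> susp /\ (y < 2)%N) -> (q = None -> susp /\ (z < 2)%N) ->
      P p y = P q z -> p = q /\ y = z,
    (forall (a b : 'I_k.+1 -> nat) w, (forall i, a i <= b i <= L)%N ->
      (\sum_i (b i - a i) ^ 2 <= s)%N -> exists c,
      (forall i y, (a i <= y <= b i)%N -> normsq (c - P (Some i) y) <= r ^+ 2) /\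
      (susp -> (w < 2)%N -> normsq (c - P None w) <= r ^+ 2)) /\
    (forall i0 w, exists c,
      (forall i y, i != i0 -> (y <= L)%N -> normsq (c - P (Some i) y) <= r ^+ 2) /\
      (susp -> (w < 2)%N -> normsq (c - P None w) <= r ^+ 2)),
    forall (a b : 'I_k.+1 -> nat) c, (forall i, a i <= L)%N ->
      (forall i, b i <= L)%N ->
      (forall i, normsq (c - P (Some i) (a i)) <= r ^+ 2) ->
      (forall i, normsq (c - P (Some i) (b i)) <= r ^+ 2) ->
      (\sum_i (b i - a i) ^ 2 <= s)%N &
    susp -> forall c, normsq (c - P None 0%N) <= r ^+ 2 ->
      normsq (c - P None 1%N) <= r ^+ 2 -> False].
Proof.
move=> L0 se sk.
pose K : R := k.+1%:R; pose l : R := L%:R.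
have K1 : 1 <= K by rewrite ler1n.
have l1 : 1 <= l by rewrite ler1n.
have iK0 : 0 < K^-1 by rewrite invr_gt0 ltr0n.
have iK1 : K^-1 <= 1 by rewrite invf_le1 ?ltr0n.
pose eps : R := (32 * K ^+ 2 * l ^+ 2)^-1.
have den0 : 0 < 32 * K ^+ 2 * l ^+ 2 by rewrite !mulr_gt0 ?exprn_gt0 ?ltr0n.
have eps0 : 0 < eps by rewrite invr_gt0.
have eps_small : eps * (32 * K ^+ 2 * l ^+ 2) <= 1.
  by rewrite mulVf // gt_eqF.
pose h : R := if susp then eps / (4 * K) else 0.
pose r2 := arc_radius2 k s eps; pose r := Num.sqrt r2.
have r20 : 1 - K^-1 <= r2.
  rewrite /r2 /arc_radius2 -/K lerDl; apply: divr_ge0; apply: mulr_ge0;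
    rewrite ?sqr_ge0 // ?exprn_ge0 ?ler0n //.
  by rewrite addr_ge0 ?mulr_ge0 ?ler0n.
have r20' : 0 <= r2 by apply: le_trans r20; rewrite subr_ge0.
have rE : r ^+ 2 = r2 by rewrite sqr_sqrtr.
have r0 : 0 <= r by apply: sqrtr_ge0.
pose H := r + h / 2.
(* Pole [w] has height (-1)^w H, and a centre that has to reach it is moved to height (-1)^w h. *)
pose sg (w : nat) : R := (-1) ^+ w.
have sg2 w : sg w ^+ 2 = 1 by rewrite sqrr_sign.
have h_small w : (sg w * h) ^+ 2 *+ (0 < e)%N <= eps ^+ 2 / (16 * K ^+ 2).
  have -> : eps ^+ 2 / (16 * K ^+ 2) = (eps / (4 * K)) ^+ 2.
    by rewrite expr_div_n exprMn; congr (_ / (_ * _)); ring.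
  rewrite exprMn sg2 mul1r /h; case: ifP => _.
    by case: (0 < e)%N; rewrite ?mulr1n ?mulr0n ?sqr_ge0.
  by rewrite expr0n mul0rn sqr_ge0.
have pole_le w : susp ->
    2 * eps ^+ 2 * l ^+ 2 + (sg w * h - sg w * H) ^+ 2 *+ (0 < e)%N <= r ^+ 2.
  move=> ss; rewrite (se ss) mulr1n -mulrBr exprMn sg2 mul1r.
  have hE : h = eps / (4 * K) by rewrite /h ss.
  (* Here [0 < k] matters: then K >= 2, so the squared circumradius 1 - 1/K is at least 1/2. *)
  have r12 : 1 / 2 <= r.
    rewrite -(@ler_pXn2r _ 2) ?nnegrE // ?divr_ge0 // rE; apply: (le_trans _ r20).
    have : K^-1 <= 2^-1 by rewrite lef_pV2 ?posrE ?ltr0n // ler_nat ltnS sk.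
    by move: (K^-1) => u; lra.
  rewrite hE /H hE; apply: pole_radius_bound => //.
  by rewrite mulVf // gt_eqF.
pose P (p : option 'I_k.+1) (y : nat) : 'rV[R]_(k + (k.+1 + e)) :=
  if p is Some i then arc_point e eps i y else pole_point k e (sg y * H).
have H0 : susp -> r < H.
  by move=> ss; rewrite /H ltrDl /h ss !divr_gt0 // mulr_gt0.
have z0 : \sum_(j < k.+1) (0 : R) = 0 by rewrite big1.
have z2 : \sum_(j < k.+1) (0 : R) ^+ 2 = 0.
  by rewrite big1 // => j _; rewrite expr0n.
have poleB w w' : susp ->
    normsq (P None w - P None w') = (sg w - sg w') ^+ 2 * H ^+ 2.
  move=> ss; rewrite /P {1}/pole_point normsq_sub_pole_point se // mulr1n.
  by rewrite z0 z2 expr0n /= mul0r subr0 !add0r -mulrBl exprMn.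
have normsq0 : normsq (0 : 'rV[R]_(k + (k.+1 + e))) = 0.
  by rewrite /normsq big1 // => m _; rewrite mxE expr0n.
have poleP i y w : susp -> P None w <> P (Some i) y.
  move=> ss PE; have := normsq_sub_arc_point e eps (fun=> 0) (fun=> 0) (sg w * H) i y.
  rewrite -[embed _ _ _ _]/(P None w) PE subrr normsq0 se // mulr1n.
  have -> : (sg w * H) ^+ 2 = H ^+ 2 by rewrite exprMn sg2 mul1r.
  rewrite z0 z2 !mulr0 !subr0 !sub0r sqrrN.
  set a := 1 - _; set u := eps * _.
  have : a ^+ 2 / k.+1%:R <= a ^+ 2.
    by rewrite ler_pdivrMr ?ltr0n // ler_peMr ?sqr_ge0 // ler1n.
  have : 0 < H ^+ 2 by rewrite exprn_gt0 // (le_lt_trans r0) // H0.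
  have := sqr_ge0 u; set v := _ / _.
  by move: (u ^+ 2) (a ^+ 2) (H ^+ 2) v => ? ? ? ? *; lra.
exists P, r; rewrite rE; split=> //.
- move=> [i|] y [j|] z yL zL py qz.
  + move/(@arc_point_inj R k e L eps eps0 L0 eps_small i j y z yL zL).
    by case=> -> ->.
  + by move=> PE; case: (poleP i y z); [have [] := qz erefl | rewrite PE].
  + by move=> PE; case: (poleP j z y); [have [] := py erefl | rewrite PE].
  have [ss ylt2] := py erefl; have [_ zlt2] := qz erefl => PE.
  split=> //; have := poleB y z ss; rewrite PE subrr normsq0 => /eqP.
  rewrite eq_sym mulf_eq0 !sqrf_eq0 (gt_eqF (le_lt_trans r0 (H0 ss))) orbF /sg.
  by case: y z ylt2 zlt2 {yL zL py qz PE} => [|[|y]] [|[|z]] //= _ _; rewrite ?expr0 ?expr1;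
    move=> /eqP E; exfalso; lra.
- split=> [a b w abL cost|i0 w].
    have [c [cP cH]] := arc_face_center eps0 L0 eps_small (h_small w) abL cost.
    by exists c; split=> // ss _; rewrite -rE (le_trans (cH _)) // pole_le.
  have [c [cP cH]] := arc_coface_center s eps0 L0 eps_small (h_small w) i0.
  by exists c; split=> // ss _; rewrite -rE (le_trans (cH _)) // pole_le.
- move=> a b c aL bL ca cb; by have := @arc_cost_le R k e s L eps eps0 eps_small a b c aL bL ca cb.
(* A point within [r] of both poles would give 4 H^2 <= 4 r^2, although [r < H]. *)
move=> ss c c0 c1; have := normsq_triangle c (P None 0%N) (P None 1%N).
rewrite poleB // /sg expr0 expr1 opprK.
have : r ^+ 2 < H ^+ 2 by rewrite ltr_pXn2r ?nnegrE ?(ltW (le_lt_trans r0 (H0 ss))) // H0.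
move: c0 c1; rewrite -rE.
move: (r ^+ 2) (H ^+ 2) (normsq _) (normsq _) => u v x y.
by move=> *; lra.
Qed.

(** * Growth of the Betti numbers *)

(* b.*2 is the number of poles. *)
Definition vertex_label (k : nat) (b : bool) (j : nat) : option 'I_k.+1 * nat :=
  if (j < b.*2)%N then (None, j)
  else (Some (inord ((j - b.*2) %% k.+1)), (j - b.*2) %/ k.+1)%N.

Lemma vertex_label_arc (k : nat) (b : bool) (i : 'I_k.+1) (y : nat) :
  vertex_label k b (y * k.+1 + i + b.*2) = (Some i, y).
Proof.
rewrite /vertex_label ltnNge leq_addl /= addnK; congr (Some _, _).
  by apply: val_inj; rewrite /= inordK ?ltn_pmod // modnMDl modn_small.
by rewrite divnMDl // divn_small ?addn0.
Qed.

Lemma vertex_labelP (k : nat) (b : bool) (j y : nat) (i : 'I_k.+1) :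
  vertex_label k b j = (Some i, y) -> j = (y * k.+1 + i + b.*2)%N.
Proof.
rewrite /vertex_label; case: ltnP => // jb [<- <-].
by rewrite inordK ?ltn_pmod // -divn_eq subnK.
Qed.

Lemma vertex_label_pole (k : nat) (b : bool) (j : nat) :
  (vertex_label k b j).1 = None ->
  [/\ b, (j < 2)%N & (vertex_label k b j).2 = j].
Proof. by rewrite /vertex_label; case: ltnP => // jb _; case: b jb. Qed.

Lemma vertex_label_inj (k : nat) (b : bool) : injective (vertex_label k b).
Proof.
move=> j j' jj'; case E : (vertex_label k b j) => [[i|] y].
  by rewrite (vertex_labelP E); move: E; rewrite jj' => /vertex_labelP ->.
have [|_ _ jE] := @vertex_label_pole k b j; first by rewrite E.
have [|_ _ jE'] := @vertex_label_pole k b j'; first by rewrite -jj' E.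
by rewrite -jE -jE' jj'.
Qed.

Lemma vertex_label_le (k : nat) (b : bool) (j : nat) :
  ((vertex_label k b j).2 <= j)%N.
Proof.
rewrite /vertex_label; case: ltnP => //= _.
exact: leq_trans (leq_div _ _) (leq_subr _ _).
Qed.

Lemma cechP (R : realType) (d : nat) (A : {fset 'rV[R]_d}) (r : R)
    (S : {set A}) : 0 <= r ->
  reflect (S != set0 /\
    exists x, forall a, a \in S -> normsq (x - val a) <= r ^+ 2)
    (S \in cech_complex A r).
Proof.
move=> r0; rewrite inE; apply: (iffP andP) => -[-> H]; split=> //.
  by case/asboolP: H => x xS; exists x => a /xS; rewrite euclidean_dist_le.
by apply/asboolP; case: H => x xS; exists x => a /xS; rewrite euclidean_dist_le.
Qed.

Lemma fset_of_family (R : realType) (d N : nat) (pt : nat -> 'rV[R]_d) :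
  (forall i j, (i < N)%N -> (j < N)%N -> pt i = pt j -> i = j) ->
  exists (A : {fset 'rV[R]_d}), #|` A| = N /\
    exists idx : A -> nat, [/\ forall v, (idx v < N)%N,
      forall v, val v = pt (idx v), injective idx &
      forall j, (j < N)%N -> exists v, idx v = j].
Proof.
move=> inj; pose s := [seq pt i | i <- iota 0 N].
have us : uniq s.
  rewrite map_inj_in_uniq ?iota_uniq // => i j.
  by rewrite !mem_iota !add0n => iN jN; apply: inj.
exists [fset x in s]%fset; split.
  by rewrite card_fseq undup_id // size_map size_iota.
have idxP (v : [fset x in s]%fset) : exists j : 'I_N, val v = pt j.
  have := valP v; rewrite in_fset /= => /mapP[j]; rewrite mem_iota add0n => jN.
  by exists (Ordinal jN).
have [idx idxE] := fin_all_exists idxP.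
exists (fun v => idx v : nat); split=> //.
  by move=> v w /val_inj vw; apply: val_inj; rewrite !idxE vw.
move=> j jN; have jA : pt j \in [fset x in s]%fset.
  by rewrite in_fset; apply: map_f; rewrite mem_iota.
by exists [` jA]%fset; apply: inj => //; rewrite -idxE.
Qed.

Lemma cech_arc_complex_exists (R : realType) (k e s N : nat) (b : bool) :
  (b -> 0 < e)%N -> (b -> 0 < k)%N ->
  exists (A : {fset 'rV[R]_(k + (k.+1 + e))}) (r : R) (idx : A -> nat),
    [/\ #|` A| = N /\ 0 <= r, forall v, (idx v < N)%N, injective idx,
      forall j, (j < N)%N -> exists v, idx v = j &
      arc_complex s (fun v => (vertex_label k b (idx v)).1)
        (fun v => (vertex_label k b (idx v)).2) (cech_complex A r)].
Proof.
move=> be bk.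
(* The bound [N.+1] exceeds all positions and is positive even for [N = 0]. *)
have [P [r [r0 Pinj [face coface] cost poles]]] :=
  arc_configuration_exists R s (ltn0Sn N) be bk.
pose lab := vertex_label k b.
pose pt j := P (lab j).1 (lab j).2.
have labN j : (j < N)%N -> ((lab j).2 <= N.+1)%N.
  by move=> jN; rewrite (leq_trans (vertex_label_le _ _ _)) // leqW // ltnW.
have pt_inj i j : (i < N)%N -> (j < N)%N -> pt i = pt j -> i = j.
  move=> iN jN /Pinj[].
  - exact: labN.
  - exact: labN.
  - by move=> /vertex_label_pole[? ? ->].
  - by move=> /vertex_label_pole[? ? ->].
  move=> l1 l2; apply: (@vertex_label_inj k b).
  by rewrite -/lab (surjective_pairing (lab i)) l1 l2 -surjective_pairing.
have [A [cardA [idx [idxN idxE idx_inj idx_surj]]]] := fset_of_family pt_inj.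
exists A, r, idx; split=> //.
pose piece (v : A) := (lab (idx v)).1; pose pos (v : A) := (lab (idx v)).2.
have posN v : (pos v <= N.+1)%N by apply: labN.
have vE v : val v = P (piece v) (pos v) by rewrite idxE.
have pieceN v : piece v = None -> b /\ (pos v < 2)%N.
  by move=> /vertex_label_pole[? ? pE]; rewrite /pos /lab pE.
have pp_inj v w : piece v = piece w -> pos v = pos w -> v = w.
  move=> pvw qvw; apply: idx_inj; apply: (@vertex_label_inj k b).
  rewrite (surjective_pairing (vertex_label k b (idx v))).
  rewrite (surjective_pairing (vertex_label k b (idx w))).
  by congr (_, _).
have pick_pole S : one_pole piece S -> exists w, forall v, v \in S ->
    piece v = None -> pos v = w.
  move=> Spole; case: (pickP (fun v => (v \in S) && (piece v == None))) => [v|no].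
    case/andP=> vS /eqP pv; exists (pos v) => u uS pu.
    by rewrite (Spole u v).
  exists 0%N => v vS pv; have := no v.
  by rewrite vS pv eqxx.
have Kpart S : S != set0 -> one_pole piece S ->
    (exists i, forall v, v \in S -> piece v <> Some i) -> S \in cech_complex A r.
  move=> S0 /pick_pole[w wS] [i iS]; apply/cechP => //; split=> //.
  have [c [cP cw]] := coface i w; exists c => v vS; rewrite vE.
  case pv: (piece v) => [j|]; last first.
    by have [bb v2] := pieceN v pv; rewrite (wS v vS pv) cw // -(wS v vS pv).
  by apply: cP => //; apply/eqP => ji; case: (iS v vS); rewrite pv ji.
split=> //.
- exact: cech_complexP.
- move=> S a' b' S0 Spole abS cs.
  (* On an arc that [S] misses, [a'] and [b'] are arbitrary, so that case goes through [Kpart]. If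
     all arcs are met, it is enough to cut [b'] off at [N.+1]. *)
  have [full|] := boolP [forall i, [exists v in S, piece v == Some i]]; last first.
    case/forallPn => i /existsPn noi; apply: Kpart => //; exists i => v vS pv.
    by have := noi v; rewrite vS pv eqxx.
  have [w wS] := pick_pole S Spole.
  have ab'L i : (a' i <= minn (b' i) N.+1 <= N.+1)%N.
    rewrite geq_minr andbT; have /existsP[v /andP[vS /eqP pv]] := forallP full i.
    have /andP[av vb] := abS v i vS pv.
    by rewrite leq_min (leq_trans av vb) (leq_trans av (posN v)).
  have cs' : (\sum_i (minn (b' i) N.+1 - a' i) ^ 2 <= s)%N.
    apply: leq_trans cs; apply: leq_sum => i _.
    by rewrite leq_sqr leq_sub2r // geq_minl.
  have [c [cP cw]] := face a' (fun i => minn (b' i) N.+1) w ab'L cs'.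
  apply/cechP => //; split=> //; exists c => v vS; rewrite vE.
  case pv: (piece v) => [j|]; last first.
    by have [bb v2] := pieceN v pv; rewrite (wS v vS pv) cw // -(wS v vS pv).
  apply: cP; have /andP[av vb] := abS v j vS pv.
  by rewrite av leq_min vb posN.
- move=> S /cechP-/(_ r0)[_ [x xS]] v w vS wS; rewrite -!/(piece _) => pv pw.
  apply: pp_inj; first by rewrite pv pw.
  have [bb v2] := pieceN v pv; have [_ w2] := pieceN w pw.
  have := xS v vS; have := xS w wS; rewrite !vE pv pw.
  by case: (pos v) (pos w) v2 w2 => [|[|y]] [|[|z]] // _ _ xw xv;
    case: (poles bb x).
move=> S a' b' /cechP-/(_ r0)[_ [x xS]] abS.
apply: (cost (fun i => pos (a' i)) (fun i => pos (b' i)) x) => // i.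
  have [aS _ pa _] := abS i; have := xS _ aS.
  by rewrite vE [piece _]pa.
have [_ bS _ pb] := abS i; have := xS _ bS.
by rewrite vE [piece _]pb.
Qed.

Lemma cech_betti_growth (R : realType) (F : fieldType) (k e s p : nat) (b : bool) :
  (b -> 0 < e)%N -> (b -> 0 < k)%N -> (s <= k)%N -> p.+1 = (k.+1 + s + b)%N ->
  exists C N0, forall N, exists (A : {fset 'rV[R]_(k + (k.+1 + e))}) (r : R),
    [/\ #|` A| = N /\ 0 <= r,
      (0 < N)%N ->
        (reduced_betti F (cech_complex A r) p <= C * N ^ k.+1)%N &
      (N0 <= N)%N ->
        (N ^ k.+1 <= C * reduced_betti F (cech_complex A r) p)%N].
Proof.
move=> be bk sk pE.
(* The first summand serves the upper bound, by 4 (N + 1) <= 8 N, the second the lower bound, by N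
   <= 5 (k + 1) n. The threshold guarantees two points on every arc even after two vertices are
   spent on poles. *)
exists (4 * 8 ^ k.+1 + (5 * k.+1) ^ k.+1)%N, (k.*2 + 4)%N => N.
have [A [r [idx [cardA idxN idx_inj idx_surj Karc]]]] :=
  cech_arc_complex_exists R s N be bk.
exists A, r; split=> //.
  move=> N0; apply: (@leq_trans (4 * (4 * N.+1) ^ k.+1)); last first.
    rewrite mulnDl (leq_trans _ (leq_addr _ _)) // -mulnA leq_mul2l /= -expnMn.
    by rewrite leq_exp2r //; lia.
  apply: (reduced_betti_arc_complex_le F p Karc).
  - move=> v w [e1 e2]; apply/idx_inj/(@vertex_label_inj k b).
    rewrite (surjective_pairing (vertex_label k b (idx v))) e1 e2.
    by rewrite -surjective_pairing.
  - by move=> v; rewrite ltnS (leq_trans (vertex_label_le _ _ _)) // ltnW.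
  - by move=> v /vertex_label_pole[_ j2 ->].
  - move=> v i y pv yv.
    have vE : idx v = ((vertex_label k b (idx v)).2 * k.+1 + i + b.*2)%N.
      by apply: vertex_labelP; rewrite -pv -surjective_pairing.
    have [|w wE] := idx_surj (y * k.+1 + i + b.*2)%N.
      apply: leq_ltn_trans (idxN v); rewrite [leqRHS]vE !leq_add2r.
      by rewrite leq_mul2r yv orbT.
    by exists w; rewrite wE vertex_label_arc.
  by rewrite -cardfE; case: cardA => ->.
move=> NN0; set beta := reduced_betti _ _ _.
(* Every arc carries at least [n.+1] points, so a pair of neighbours has [n] possible lower ends. *)
pose M := (N - b.*2)%N; pose n := (M %/ k.+1).-1.
have b2 : (b.*2 <= 2)%N by case: (b).
have Mn : (n.+1 * k.+1 <= M)%N.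
  rewrite /n prednK ?leq_trunc_div // divn_gt0 //; rewrite /M; lia.
have Nn : (N <= 5 * k.+1 * n)%N.
  have := divn_eq M k.+1; have := ltn_pmod M (ltn0Sn k).
  have : (1 < M %/ k.+1)%N by rewrite leq_divRL // /M; lia.
  rewrite /n; case: (M %/ k.+1)%N => [|[|q]] //= _; rewrite /M; nia.
suff nb : (n ^ k.+1 <= beta)%N.
  apply: (@leq_trans ((5 * k.+1) ^ k.+1 * n ^ k.+1)).
    by rewrite -expnMn leq_exp2r.
  by rewrite leq_mul // leq_addl.
have vx_ex (iy : 'I_k.+1 * 'I_n.+1) : exists v : A,
    (vertex_label k b (idx v)) = (Some iy.1, iy.2 : nat).
  have [|v vE] := idx_surj (iy.2 * k.+1 + iy.1 + b.*2)%N; last first.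
    by exists v; rewrite vE vertex_label_arc.
  have := ltn_ord iy.1; have := ltn_ord iy.2; rewrite /M in Mn; nia.
have [vx0 vx0P] := fin_all_exists vx_ex.
pose E := [set i : 'I_k.+1 | (i < s.+1)%N].
have cardE : #|E| = s.+1.
  have -> : E = [set widen_ord (sk : s < k.+1)%N i | i : 'I_s.+1].
    apply/setP => i; rewrite inE; apply/idP/imsetP => [is1|[j _ ->]].
      by exists (Ordinal is1) => //; apply: val_inj.
    exact: ltn_ord j.
  rewrite card_imset ?cardsT ?card_ord // => i j ij.
  by apply: val_inj; move/(congr1 val): ij.
have vxP (i : 'I_k.+1) (y : 'I_n.+1) :
    (vertex_label k b (idx (vx0 (i, y)))).1 = Some i /\
    (vertex_label k b (idx (vx0 (i, y)))).2 = y.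
  by rewrite vx0P.
have pp_inj : injective (fun v : A =>
    ((vertex_label k b (idx v)).1, (vertex_label k b (idx v)).2)).
  move=> v w [e1 e2]; apply/idx_inj/(@vertex_label_inj k b).
  rewrite (surjective_pairing (vertex_label k b (idx v))) e1 e2.
  by rewrite -surjective_pairing.
have i0E : ord0 \in E by rewrite inE.
case bE: b pE => pE; last first.
  apply: (arc_complex_betti_ge_no_pole (W := set0) F Karc pp_inj vxP i0E cardE _ _) => //.
    by move=> v /vertex_label_pole[]; rewrite bE.
  by rewrite pE addn0.
have [|w0 w0E] := idx_surj 0%N; first by lia.
have [|w1 w1E] := idx_surj 1%N; first by lia.
have labw j : (j < 2)%N -> vertex_label k b j = (None, j).
  by move=> j2; rewrite /vertex_label bE j2.
apply: (arc_complex_betti_ge_two_poles (W := [set w0]) F Karc pp_inj vxP i0E cardE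
  (w0 := w0) (w1 := w1)) => //.
- by rewrite w0E labw.
- by rewrite w1E labw.
- by apply: contra_eq_neq w0E => ->; rewrite w1E.
- move=> v /vertex_label_pole[_ + _]; case vE: (idx v) => [|[|]] // _.
    by left; apply: idx_inj; rewrite w0E.
  by right; apply: idx_inj; rewrite w1E.
by move: pE; lia.
Qed.

(** * The strip for d = 2 and p = 1 *)

Lemma normsq_rV2 (R : realType) (x : 'rV[R]_2) : normsq x = x 0 0 ^+ 2 + x 0 1 ^+ 2.
Proof.
rewrite /normsq big_ord_recl big_ord_recl big_ord0 addr0.
by congr (x 0 _ ^+ 2 + x 0 _ ^+ 2); apply: val_inj.
Qed.

Lemma strip_ball_near (R : realType) (x y o o' : R) (i j : nat) :
  (x - i%:R) ^+ 2 + (y - o) ^+ 2 <= 1 -> (x - j%:R) ^+ 2 + (y - o') ^+ 2 <= 1 ->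
  (j <= i + 2)%N.
Proof.
have bound (u v : R) : u ^+ 2 + v ^+ 2 <= 1 -> -1 <= u <= 1.
  move=> uv; rewrite -ler_norml -(@expr_le1 _ 2) // real_normK ?num_real //.
  by apply: le_trans uv; rewrite lerDl sqr_ge0.
move=> /bound/andP[xi xi'] /bound/andP[xj xj']; rewrite leqNgt; apply/negP => ij.
have : (i + 3)%:R <= j%:R :> R by rewrite ler_nat; lia.
rewrite natrD => ijR.
lra.
Qed.

(** The outer two centres are at distance 2, so their unit balls meet only in the midpoint, which
    lies 3/2 away from the height of the middle centre. *)
Lemma strip_ball_no_triple (R : realType) (x y : R) (j : nat) :
  (x - j%:R) ^+ 2 + (y - 3 / 2 * (odd j)%:R) ^+ 2 <= 1 ->
  (x - j.+1%:R) ^+ 2 + (y - 3 / 2 * (odd j.+1)%:R) ^+ 2 <= 1 ->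
  (x - j.+2%:R) ^+ 2 + (y - 3 / 2 * (odd j.+2)%:R) ^+ 2 <= 1 -> False.
Proof.
rewrite -[j.+2%:R]natr1 -[j.+1%:R]natr1 /= negbK; set a := j%:R.
set h := 3 / 2 * (odd j)%:R => A1 A2 A3.
have yh : y - h = 0.
  apply/eqP; rewrite -sqrf_eq0 eq_le sqr_ge0 andbT.
  have := sqr_ge0 (x - a - 1); move: A1 A3.
  rewrite (_ : (x - a) ^+ 2 = (x - a - 1) ^+ 2 + 2 * (x - a - 1) + 1); last by ring.
  rewrite (_ : (x - (a + 1 + 1)) ^+ 2 = (x - a - 1) ^+ 2 - 2 * (x - a - 1) + 1); last by ring.
  by move: (x - a - 1) ((x - a - 1) ^+ 2) ((y - h) ^+ 2) => ? ? ? *; lra.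
have : (y - 3 / 2 * (~~ odd j)%:R) ^+ 2 = 9 / 4.
  have -> : y = h by apply/eqP; rewrite -subr_eq0 yh.
  by rewrite /h; case: (odd j) => /=; field.
have := sqr_ge0 (x - (a + 1)); move: A2.
by move: ((x - (a + 1)) ^+ 2) ((y - 3 / 2 * (~~ odd j)%:R) ^+ 2) => ? ? *; lra.
Qed.

(* The poles would need k >= 2, so d = 2 and p = 1 is treated apart: the vertices of
   a triangulated strip whose edges have circumradius at most 1 and whose triangles
   have circumradius more than 1, so each of them leaves a hole. *)
Lemma cech_strip_growth (R : realType) (F : fieldType) :
  exists C N0, forall N, exists (A : {fset 'rV[R]_2}) (r : R),
    [/\ #|` A| = N /\ 0 <= r,
      (0 < N)%N -> (reduced_betti F (cech_complex A r) 1 <= C * N ^ 1)%N &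
      (N0 <= N)%N -> (N ^ 1 <= C * reduced_betti F (cech_complex A r) 1)%N].
Proof.
(* There are at most 2 N edges and at least N - 2 independent cycles, and N <= 3 (N - 2) for N >=
   3. *)
exists 3%N, 3%N => N.
pose pt (j : nat) : 'rV[R]_2 :=
  \row_(l < 2) if l == 0 then j%:R else 3 / 2 * (odd j)%:R.
have ptE x j : normsq (x - pt j) =
    (x 0 0 - j%:R) ^+ 2 + (x 0 1 - 3 / 2 * (odd j)%:R) ^+ 2.
  by rewrite normsq_rV2 !mxE.
have pt_inj i j : (i < N)%N -> (j < N)%N -> pt i = pt j -> i = j.
  move=> _ _ /rowP/(_ 0); rewrite !mxE /= => /eqP.
  by rewrite eqr_nat => /eqP.
have [A [cardA [idx [idxN idxE idx_inj idx_surj]]]] := fset_of_family pt_inj.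
exists A, 1; set K := cech_complex A 1.
have Kin S : S != set0 -> (exists x y : R, forall v, v \in S ->
    (x - (idx v)%:R) ^+ 2 + (y - 3 / 2 * (odd (idx v))%:R) ^+ 2 <= 1) -> S \in K.
  move=> S0 [x [y xyS]]; apply/cechP => //; split=> //.
  exists (\row_(l < 2) if l == 0 then x else y) => v /xyS.
  by rewrite idxE ptE !mxE /= expr1n.
have Kout S : S \in K -> exists x y : R, forall v, v \in S ->
    (x - (idx v)%:R) ^+ 2 + (y - 3 / 2 * (odd (idx v))%:R) ^+ 2 <= 1.
  case/cechP=> // _ [x xS]; exists (x 0 0), (x 0 1) => v /xS.
  by rewrite idxE ptE expr1n.
have Knear S v w : S \in K -> v \in S -> w \in S -> (idx w <= idx v + 2)%N.
  by case/Kout=> x [y xyS] /xyS vS /xyS; apply: strip_ball_near vS.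
split=> //; rewrite expn1.
  move=> N0; have [v0 _] := idx_surj 0%N N0.
  pose decode (c : 'I_N * bool) : {set A} :=
    [set v | (idx v == c.1) || (idx v == c.1.+1 + c.2)%N].
  apply: (@leq_trans (N * 2)); last by rewrite mulnC leq_mul2r orbT.
  apply: (@leq_trans #|decode @: [set: _]|); last first.
    apply: leq_trans (leq_imset_card _ _) _.
    by rewrite cardsT card_prod card_ord card_bool.
  (* With the empty matching every edge is critical; an edge is encoded by its lower end and by
     whether it skips an index. *)
  apply: (@reduced_betti_le_critical F A K set0 _ 1 (fun=> v0) (fun=> 0%N)).
  - by move=> T; rewrite inE.
  - by move=> T T'; rewrite inE.
  move=> S SK /eqP/cards2P[x [y [xy SE]]]; constructor 1.
  wlog xlt : x y xy SE / (idx x < idx y)%N.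
    move=> H; have : idx x <> idx y by move/idx_inj => xE; rewrite xE eqxx in xy.
    case: (ltngtP (idx x) (idx y)) => // lt _; first exact: (H x y).
    by apply: (H y x) => //; [rewrite eq_sym|rewrite setUC].
  have xylt : (idx y <= idx x + 2)%N by apply: (Knear S) => //; rewrite SE ?set21 ?set22.
  apply/imsetP; exists (Ordinal (idxN x), idx y == (idx x).+2); rewrite ?inE //.
  rewrite SE; apply/setP => v; rewrite !inE /= -!(inj_eq idx_inj); congr (_ || _).
  by congr (_ == _); case: eqP => /=; lia.
move=> N3.
have tri_ex (i : 'I_(N - 2)) : exists t : A * A * A,
    [/\ idx t.1.1 = i, idx t.1.2 = i.+1 & idx t.2 = i.+2].
  have iN : (i.+2 < N)%N by have := ltn_ord i; lia.
  have [u uE] := idx_surj _ (ltnW (ltnW iN)).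
  have [v vE] := idx_surj _ (ltnW iN).
  have [w wE] := idx_surj _ iN.
  by exists (u, v, w).
have [t tP] := fin_all_exists tri_ex.
pose Q i := (t i).1.2 |: [set (t i).1.1; (t i).2].
(* The edge that skips the middle index is a maximal face and lies in no other triangle [Q j], so a
   constant rank suffices. *)
pose face i := [set (t i).1.1; (t i).2].
have QP i v : (v \in Q i) = (i <= idx v <= i + 2)%N.
  have [t0 t1 t2] := tP i.
  by rewrite !inE -!(inj_eq idx_inj) t0 t1 t2; lia.
have faceP i v : (v \in face i) = (idx v == i) || (idx v == i + 2)%N.
  have [t0 t1 t2] := tP i.
  by rewrite !inE -!(inj_eq idx_inj) t0 t2 addn2.
have t1face i : (t i).1.2 \notin face i.
  by have [_ t1 _] := tP i; rewrite faceP t1; lia.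
have cardQ i : #|Q i| = 3.
  rewrite cardsU1 t1face cards2 -(inj_eq idx_inj).
  by have [-> _ ->] := tP i; rewrite ltn_eqF.
suff nb : (N - 2 <= reduced_betti F K 1)%N by lia.
rewrite -[X in (X <= _)%N]card_ord.
apply: (@reduced_betti_ge_maximal_faces F A _ K 1 (fun i => simplex_chain F (Q i))
  face (fun=> 0%N)).
- exact: cech_complexP.
- move=> i T /boundary_simplex_neq0[w wT wQ].
  have cT : #|T| = 2 by have := cardQ i; rewrite -wQ cardsU1 wT add1n => -[].
  split=> //; apply: Kin; first by rewrite -card_gt0 cT.
  have TP v : v \in T -> (i <= idx v <= i + 2)%N /\ idx v <> idx w.
    move=> vT; rewrite -QP -wQ setU1r //; split=> // /idx_inj vw.
    by rewrite -vw vT in wT.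
  have := setU11 w T; rewrite wQ QP => wi.
  have [wE|wE] := eqVneq (idx w) i.+1.
    exists (i.+1%:R), (3 / 2 * (odd i)%:R) => v /TP[vi vw].
    have [->|->] : idx v = i \/ idx v = i.+2 by lia.
      by rewrite subrr expr0n addr0 -natr1 addrC addKr expr1n.
    rewrite /= negbK subrr expr0n addr0 -[i.+2%:R]natr1 opprD addrA subrr sub0r.
    by rewrite sqrrN expr1n.
  (* [j] is the lower end of the short edge that remains; its midpoint has squared distance 1/4 +
     9/16 to both ends. *)
  pose j := if idx w == i then i.+1 else i : nat.
  exists (j%:R + 1 / 2), (3 / 4) => v /TP[vi vw].
  have o (b : bool) : (3 / 4 - 3 / 2 * b%:R) ^+ 2 = 9 / 16 :> R.
    by case: b => /=; field.
  have [->|->] : idx v = j \/ idx v = j.+1.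
    by rewrite /j; move: wi vi vw wE; case: (idx w =P i :> nat); lia.
    rewrite o (_ : j%:R + 1 / 2 - j%:R = 1 / 2); last by field.
    by lra.
  rewrite o -[j.+1%:R]natr1.
  rewrite (_ : j%:R + 1 / 2 - (j%:R + 1) = - (1 / 2)); last by field.
  by lra.
- move=> i v vf; apply/negP => vK; have vS := setU11 v (face i).
  have [t0 t1 t2] := tP i.
  have t0S : (t i).1.1 \in v |: face i by rewrite setU1r // set21.
  have t2S : (t i).2 \in v |: face i by rewrite setU1r // set22.
  have := Knear _ _ _ vK t0S vS; have := Knear _ _ _ vK vS t2S.
  rewrite t0 t2 => h1 h2.
  have vE : idx v = i.+1 by move: vf; rewrite faceP; lia.
  have [x [y xy]] := Kout _ vK.
  have := xy _ t0S; have := xy _ vS; have := xy _ t2S; rewrite t0 t2 vE => A3 A2 A1.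
  exact: (strip_ball_no_triple A1 A2 A3).
- by move=> i; rewrite boundary_simplex_setU1 ?incidence_sign_neq0.
move=> i j /boundary_simplex_neq0[w _ wQ]; left; apply: val_inj => /=.
have sub v : v \in face j -> v \in Q i by move=> vj; rewrite -wQ setU1r.
have [t0 t1 t2] := tP j.
have := sub _ (set21 _ _); have := sub _ (set22 _ _).
by rewrite !QP t0 t2; lia.
Qed.

(* Asymptotic notation and choice of the parameters *)
From mathcomp Require Import classical_sets topology normedtype landau.
Import numFieldNormedType.Exports.
Local Open Scope classical_set_scope.

Lemma eqTheta_natr (R : realType) (f : nat -> nat) (m C N0 : nat) :
  (forall N, (0 < N)%N -> (f N <= C * N ^ m)%N) ->
  (forall N, (N0 <= N)%N -> (N ^ m <= C * f N)%N) ->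
  (fun N : nat => (f N)%:R : R^o) =Theta_\oo (fun N : nat => N%:R ^+ m : R^o).
Proof.
move=> fle fge; rewrite eqThetaE; apply/asboolP.
(* The successor keeps the constants positive even if [C] is zero. *)
have C0 : (0 : R) < C.+1%:R by rewrite ltr0n.
exists (C.+1%:R^-1, C.+1%:R); first by rewrite /= invr_gt0 C0.
near=> N; rewrite /= -natrX !normr_nat; split.
  rewrite ler_pdivrMl // -natrM ler_nat (leq_trans (fge N _)) //.
    by near: N; exists N0.
  by rewrite leq_mul2r leqnSn orbT.
rewrite -natrM ler_nat (leq_trans (fle N _)) //; first by near: N; exists 1%N.
by rewrite leq_mul2r leqnSn orbT.
Unshelve. all: by end_near.
Qed.

Theorem mainTheorem1 (R : realType) (F : fieldType) (d p : nat)
    (hd : (1 <= d)%N) (hp : (p <= d - 1)%N) :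
  exists (A : nat -> {fset 'rV[R]_d}) (r : nat -> R),
    (forall N : nat, (1 <= N)%N -> #|` A N| = N /\ 0 <= r N) /\
    (fun N : nat => (reduced_betti F (cech_complex (A N) (r N)) p)%:R : R^o)
      =Theta_\oo
    (fun N : nat => N%:R ^+ minn (p + 1) (uphalf d) : R^o).
Proof.
pose growing d p m := exists C N0, forall N,
  exists (A : {fset 'rV[R]_d}) (r : R),
  [/\ #|` A| = N /\ 0 <= r,
    (0 < N)%N -> (reduced_betti F (cech_complex A r) p <= C * N ^ m)%N &
    (N0 <= N)%N -> (N ^ m <= C * reduced_betti F (cech_complex A r) p)%N].
suff [C [N0 growth]] : growing d p (minn (p + 1) (uphalf d)).
  have [A AP] := choice growth; have [r rP] := choice AP.
  exists A, r; split=> [N _|]; first by have [] := rP N.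
  apply: (@eqTheta_natr _ _ _ C N0) => N; by have [] := rP N.
have dE := odd_double_half d.
have uE := uphalf_half d; have o1 : (odd d <= 1)%N by case: (odd d).
have dimension k e s (b : bool) : d = (k + (k.+1 + e))%N ->
    minn (p + 1) (uphalf d) = k.+1 -> (b -> 0 < e)%N -> (b -> 0 < k)%N ->
    (s <= k)%N -> p.+1 = (k.+1 + s + b)%N -> growing d p (minn (p + 1) (uphalf d)).
  by move=> ed -> be bk sk pE; rewrite ed; apply: cech_betti_growth be bk sk pE.
(* For p + 1 <= ceil(d/2) there are p + 1 arcs and [s] is zero. *)
have [pd|dp] := leqP p.+1 (uphalf d).
  apply: (@dimension p (d - (p + p.+1))%N 0%N false) => //; lia.
pose k := (uphalf d).-1.
(* Here ceil(d/2) = k + 1 arcs are used, and s = p - k is admissible as long as it is at most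
   [k]. *)
have [pk|kp] := leqP p.+1 (k.+1 + k).
  apply: (@dimension k (d - (k + k.+1))%N (p - k)%N false) => //; rewrite /k; lia.
(* What remains is d = 2 k + 2 with p = d - 1. Unless d = 2, [k] is positive, and the one spare
   dimension carries the poles. *)
have [d2|d2] := eqVneq d 2.
  have -> : p = 1%N by lia.
  by rewrite d2; apply: cech_strip_growth.
by apply: (@dimension k 1%N k true) => //; move: kp; rewrite /k; lia.
Qed.
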